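(* Let $\Bbbk$ be a field, and let $G$ be a finite group such that the augmentation ideal $\mathfrak a\lhd\Bbbk[G]$ is nilpotent. Let $X$ be a simplicial set, $\tau\colon X_{>0}\to G$ a twisting function, and $F$ a finite discrete left $G$-space. There is a multiplicative spectral sequence $\mathcal E_r$ converging to $H^*(X\times_\tau F)$ whose first page is of the form $$\mathcal E_1^{p,q}=H^{p+q}(X)\otimes\mathrm{gr}^q(F)$$ with componentwise product, where $\mathrm{gr}^*(F)$ is the graded algebra associated to the filtration $$\mathcal F^{-p}(F)=\{\gamma\in C^0(F)\mid\gamma(m)=0\text{ for all }m\in\mathfrak a^{p+1}C(F)\},\qquad p\ge0,$$ of $C^*(F)=C^0(F)$. The spectral sequence is natural in $X$, $G$ and $F$.
   Context: $C(-)$ and $C^*(-)$ denote normalized (co)chains with coefficients in $\Bbbk$, $H^*$ is cohomology with coefficients in $\Bbbk$. The group $G$ is regarded as a constant simplicial group and the finite $G$-set $F$ as a constant simplicial set, so $C(G)=\Bbbk[G]$, $C(F)=C_0(F)=\Bbbk[F]$ and $C^*(F)=C^0(F)$ is the algebra of functions $F\to\Bbbk$. A twisting function $\tau\colon X_{>0}\to G$ satisfies, for $x\in X_n$, $n>0$ (whenever defined): $\partial_0\tau(x)=\tau(\partial_0x)^{-1}\tau(\partial_1x)$; $\partial_k\tau(x)=\tau(\partial_{k+1}x)$ for $0<k<n$; $s_k\tau(x)=\tau(s_{k+1}x)$ for $0\le k<n$; and $\tau(s_0x)=1$ for all $x$ (faces and degeneracies of the constant simplicial group $G$ being identities). The twisted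 Cartesian product $X\times_\tau F$ is $X\times F$ except that $\partial_0(x,y)=(\partial_0x,\tau(x)\,\partial_0y)$. The filtration is multiplicative: $\mathcal F^{-p}(F)\cdot\mathcal F^{-q}(F)\subset\mathcal F^{-p-q}(F)$; $\mathrm{gr}^{-p}(F)=\mathcal F^{-p}(F)/\mathcal F^{-p+1}(F)$ with $\mathcal F^{1}(F)=0$. In $\mathcal E_r^{p,q}$ the index $q\le0$ is the filtration degree and $p+q$ the total cohomological degree; $\mathrm{gr}^*(F)$ carries cohomological degree $0$. Naturality refers to maps of $X$, $G$ and $F$ compatible with twisting functions and actions. *)

(* Defs.v *)
From HB Require Import structures.
From mathcomp Require Import all_boot all_order fingroup all_algebra.
From mathcomp Require Import generic_quotient.
From mathcomp Require Import ring zify.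
From mathcomp Require Import boolp classical_sets functions.
Set Implicit Arguments.
Unset Strict Implicit.
Unset Printing Implicit Defensive.
Import Order.TTheory GRing.Theory Num.Theory.
Local Open Scope ring_scope.
Local Open Scope quotient_scope.

Section Subquotient.
Variables (k : fieldType) (V : lmodType k).
Implicit Types Z B : submodClosed V.

(* [subquo Z B] is the quotient Z / (Z :&: B), used for B contained in Z. *)
Record subspace Z := Subspace { subspace_val : V; _ : subspace_val \in Z }.
HB.instance Definition _ Z := [isSub for @subspace_val Z].
HB.instance Definition _ Z := [Choice of subspace Z by <:].
HB.instance Definition _ Z := [SubChoice_isSubLmodule of subspace Z by <:].

Definition restr Z B : {pred subspace Z} := fun z => \val z \in B.
Fact restr_closed Z B : submod_closed (@restr Z B).
Proof.
split=> [|a x y hx hy]; first by rewrite -topredE /= /restr raddf0 rpred0.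
by rewrite -topredE /= /restr linearP rpredD ?rpredZ.
Qed.
HB.instance Definition _ Z B :=
  GRing.isSubmodClosed.Build k (subspace Z) (@restr Z B) (@restr_closed Z B).

Definition subquo Z B : Type := Quotient.quot (@restr Z B).
HB.instance Definition _ Z B := GRing.Zmodule.on (subquo Z B).
HB.instance Definition _ Z B := EqQuotient.on (subquo Z B).

Section Lmod.
Variables Z B : submodClosed V.
Local Notation Q := (subquo Z B).

Definition subquo_scale (a : k) (x : Q) : Q := \pi_Q (a *: repr x).

Lemma subquo_eqP (x y : subspace Z) :
  reflect (\pi_Q x = \pi_Q y) (\val x - \val y \in B).
Proof.
rewrite -[_ - _](raddfB (\val : subspace Z -> V)).
have -> : (\val (x - y) \in B) = (x - y \in @restr Z B) by [].
rewrite Quotient.idealrBE; exact: eqP.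
Qed.

Lemma subquo_scaleE a x : subquo_scale a (\pi_Q x) = \pi_Q (a *: x).
Proof.
apply/subquo_eqP; rewrite !linearZ /= -scalerDr rpredZ //.
by apply/subquo_eqP; rewrite reprK.
Qed.

Lemma subquo_piD x y : \pi_Q x + \pi_Q y = \pi_Q (x + y).
Proof. exact: esym (@Quotient.pi_add _ (@restr Z B) x y). Qed.

Fact subquo_scaleA a b v :
  subquo_scale a (subquo_scale b v) = subquo_scale (a * b) v.
Proof. by rewrite -[v]reprK !subquo_scaleE reprK scalerA. Qed.

Fact subquo_scale1 : left_id 1 subquo_scale.
Proof. by move=> v; rewrite -[v]reprK subquo_scaleE scale1r. Qed.

Fact subquo_scaleDr : right_distributive subquo_scale +%R.
Proof.
move=> a x y; rewrite -[x]reprK -[y]reprK subquo_piD !subquo_scaleE.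
by rewrite subquo_piD scalerDr.
Qed.

Fact subquo_scaleDl v : {morph subquo_scale^~ v : a b / a + b}.
Proof.
by move=> a b /=; rewrite -[v]reprK !subquo_scaleE subquo_piD scalerDl.
Qed.

End Lmod.

HB.instance Definition _ Z B := GRing.Zmodule_isLmodule.Build k (subquo Z B)
  (@subquo_scaleA Z B) (@subquo_scale1 Z B) (@subquo_scaleDr Z B)
  (@subquo_scaleDl Z B).

(* [cls Z B v] is the class of [v], meaningful for [v \in Z] only; [rep] picks a
   representative in [Z]. *)
Definition cls Z B (v : V) : subquo Z B := \pi_(subquo Z B) (insubd 0 v).
Definition rep Z B (x : subquo Z B) : V := \val (repr x).
Arguments cls : clear implicits.

Lemma rep_in Z B (x : subquo Z B) : rep x \in Z.
Proof. exact: valP. Qed.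

Lemma repK Z B (x : subquo Z B) : cls Z B (rep x) = x.
Proof. by rewrite /cls /rep valKd reprK. Qed.

Lemma clsP Z B u v : u \in Z -> v \in Z ->
  reflect (cls Z B u = cls Z B v) (u - v \in B).
Proof.
move=> Zu Zv; have := @subquo_eqP Z B (insubd 0 u) (insubd 0 v).
by rewrite !insubdK.
Qed.

Lemma cls_rep Z B v : v \in Z -> rep (cls Z B v) - v \in B.
Proof. by move=> Zv; apply/(clsP B (rep_in _) Zv); rewrite repK. Qed.

Lemma clsD Z B a u v : u \in Z -> v \in Z ->
  cls Z B (a *: u + v) = a *: cls Z B u + cls Z B v.
Proof.
move=> Zu Zv; have -> : a *: cls Z B u = \pi_(subquo Z B) (a *: insubd 0 u).
  exact: subquo_scaleE.
rewrite subquo_piD; apply/subquo_eqP; rewrite linearP /= !insubdK //.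
  by rewrite scalerN -opprD subrr rpred0.
by apply: rpredD => //; apply: rpredZ.
Qed.

End Subquotient.
Arguments cls {k V} Z B v.
Arguments rep {k V Z B} x.

Section Linear.
Variable k : fieldType.
Implicit Types U V W T : lmodType k.

Inductive span V (S : V -> Prop) : V -> Prop :=
| span0 : span S 0
| spanD a u v : S u -> span S v -> span S (a *: u + v).

Definition bilinear_map U V W (b : U -> V -> W) : Prop :=
  (forall v, linear (b^~ v)) /\ (forall u, linear (b u)).

Definition is_tensor_product U V W (b : U -> V -> W) : Prop :=
  bilinear_map b /\
  forall T (g : U -> V -> T), bilinear_map g ->
    exists h : {linear W -> T}, (forall u v, h (b u v) = g u v) /\
      forall h' : {linear W -> T}, (forall u v, h' (b u v) = g u v) -> h' =1 h.

End Linear.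

(* Faces and degeneracies are indexed by [nat]; on n-simplices only the indices
   i <= n are meaningful: the others are unconstrained and never used. *)
Record sset := SSet {
  simplex :> nat -> Type;
  face : forall n, nat -> simplex n.+1 -> simplex n;
  degen : forall n, nat -> simplex n -> simplex n.+1;
  face_face : forall n i j (x : simplex n.+2), (i < j <= n.+2)%N ->
    face i (face j x) = face j.-1 (face i x);
  face_degen_lt : forall n i j (x : simplex n.+1), (i < j <= n.+1)%N ->
    face i (degen j x) = degen j.-1 (face i x);
  face_degen_id : forall n i j (x : simplex n), (j <= n)%N ->
    (i == j) || (i == j.+1) -> face i (degen j x) = x;
  face_degen_gt : forall n i j (x : simplex n.+1), (j.+1 < i <= n.+2)%N ->
    face i (degen j x) = degen j (face i.-1 x);
  degen_degen : forall n i j (x : simplex n), (i <= j <= n)%N ->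
    degen i (degen j x) = degen j.+1 (degen i x)
}.

Record sset_map (X Y : sset) := SSetMap {
  smap :> forall n, X n -> Y n;
  smap_face : forall n i (x : X n.+1), (i <= n.+1)%N ->
    smap (face i x) = face i (smap x);
  smap_degen : forall n i (x : X n), (i <= n)%N ->
    smap (degen i x) = degen i (smap x)
}.

Section Cohomology.
Variables (k : fieldType) (X : sset).

Definition cochain (n : nat) : lmodType k := X n -> k^o.

Definition normalized n : cochain n -> Prop :=
  match n with
  | 0 => fun=> True
  | m.+1 => fun c => forall i (x : X m), (i <= m)%N -> c (degen i x) = 0
  end.

Definition cobound n (c : cochain n) : cochain n.+1 :=
  fun x => \sum_(i < n.+2) (-1) ^+ i * c (face i x).

Definition cocycles n : {pred cochain n} :=
  fun c => `[< normalized c /\ cobound c = 0 >].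

Definition coboundaries n : {pred cochain n} :=
  match n with
  | 0 => fun c => c == 0
  | m.+1 => fun c => `[< exists2 b : cochain m, normalized b & c = cobound b >]
  end.

Lemma normalized0 n : normalized (0 : cochain n).
Proof. by case: n. Qed.

Lemma normalizedD n a (c c' : cochain n) :
  normalized c -> normalized c' -> normalized (a *: c + c').
Proof.
case: n c c' => //= n c c' hc hc' i x hi.
by rewrite -[LHS]/(a * c (degen i x) + c' (degen i x)) hc // hc' // mulr0 addr0.
Qed.

Lemma cobound_linear n : linear (@cobound n).
Proof.
move=> a c c'; apply/funext=> x.
rewrite -[RHS]/(a * cobound c x + cobound c' x) /cobound mulr_sumr -big_split.
apply: eq_bigr => i _ /=.
by rewrite -[(a *: c + c') _]/(a * c (face i x) + c' (face i x)) mulrDr mulrCA.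
Qed.

HB.instance Definition _ n :=
  GRing.isLinear.Build k (cochain n) (cochain n.+1) *:%R (@cobound n)
    (@cobound_linear n).

Fact cocycles_closed n : submod_closed (@cocycles n).
Proof.
split=> [|a c c' /asboolP[h1 h2] /asboolP[h1' h2']]; apply/asboolP; split.
- exact: normalized0.
- exact: linear0.
- exact: normalizedD.
- by rewrite cobound_linear h2 h2' scaler0 addr0.
Qed.
HB.instance Definition _ n :=
  GRing.isSubmodClosed.Build k (cochain n) (@cocycles n) (@cocycles_closed n).

Fact coboundaries_closed n : submod_closed (@coboundaries n).
Proof.
case: n => [|n]; split.
- exact: eqxx.
- by move=> a c c' /eqP-> /eqP->; rewrite -topredE /= scaler0 addr0.
- by apply/asboolP; exists 0; [exact: normalized0 | rewrite linear0].
move=> a c c' /asboolP[b h ->] /asboolP[b' h' ->]; apply/asboolP.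
by exists (a *: b + b'); [exact: normalizedD | rewrite cobound_linear].
Qed.
HB.instance Definition _ n :=
  GRing.isSubmodClosed.Build k (cochain n) (@coboundaries n)
    (@coboundaries_closed n).

Definition cohomology n : lmodType k := subquo (@cocycles n) (@coboundaries n).

(* [front x] is the face of [x] on the first m + 1 vertices, [back x] the one on
   the last n + 1 vertices; [cup] is the Alexander-Whitney product. *)
Fixpoint frontr m n : X (n + m) -> X m :=
  match n with 0 => id | n'.+1 => fun x => frontr (face (n' + m).+1 x) end.

Definition front m n (x : X (m + n)) : X m :=
  frontr (ecast l (X l) (addnC m n) x).

Fixpoint back m n : X (m + n) -> X n :=
  match m with 0 => id | m'.+1 => fun x => back (face 0 x) end.

Definition cup m n (c : cochain m) (c' : cochain n) : cochain (m + n) :=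
  fun x => c (front x) * c' (back x).

(* Independence of the representatives is [hcupE]; see also [hmapE], [fgr_mulE]
   and [fgr_mapE] for the analogous definitions below. *)
Definition hcup m n (a : cohomology m) (b : cohomology n) :
    cohomology (m + n) :=
  cls _ _ (cup (rep a) (rep b)).

End Cohomology.
Arguments cocycles : clear implicits.
Arguments coboundaries : clear implicits.

Section CohomologyTheory.
Variables (k : fieldType) (X : sset).

Lemma cobound_normalized n (c : cochain k X n) :
  normalized c -> normalized (cobound c).
Proof.
case: n c => [|n] c hc /= j x hj; rewrite /cobound.
  have -> : j = 0%N by case: j hj.
  rewrite !big_ord_recl big_ord0 /= !face_degen_id //.
  by rewrite expr0 expr1 mul1r mulN1r addr0 subrr.
have hj2 : (j.+1 < n.+3)%N by rewrite !ltnS.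
rewrite (bigD1 (Ordinal (ltnW hj2))) // (bigD1 (Ordinal hj2)) /=; last first.
  by rewrite -val_eqE /= gtn_eqF.
rewrite !face_degen_id ?eqxx ?orbT // exprS mulN1r mulNr addrA subrr add0r.
rewrite big1 // => i /andP[]; rewrite -!val_eqE /= => ij ij1.
case: (ltngtP i j) => [lij|lij|eij]; last by rewrite eij eqxx in ij.
  rewrite face_degen_lt ?lij //= hc ?mulr0 //.
  by case: j hj lij {ij ij1 hj2}.
have lij1 : (j.+1 < i)%N by rewrite ltn_neqAle eq_sym ij1.
rewrite face_degen_gt; last by rewrite lij1 -ltnS ltn_ord.
rewrite hc ?mulr0 //; have := ltn_ord i; rewrite [(_ < n.+3)%N]ltnS => hi.
exact: leq_trans lij1 hi.
Qed.

Lemma cobound_cobound n (c : cochain k X n) : cobound (cobound c) = 0.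
Proof.
apply/funext=> x; rewrite /cobound [RHS]/(0 : k).
pose g i j : k := c (face i (face j x)).
have gE i j : (i < j <= n.+2)%N -> g i j = g j.-1 i.
  by move=> h; rewrite /g face_face.
transitivity (\sum_(j < n.+3)
  ((\sum_(i < n.+2 | (i < j)%N) (-1) ^+ (i + j) * g i j)
   + \sum_(i < n.+2 | ~~ (i < j)%N) (-1) ^+ (i + j) * g i j)).
  apply: eq_bigr => j _; rewrite mulr_sumr.
  rewrite (bigID (fun i : 'I_n.+2 => (i < j)%N)) /=.
  by congr (_ + _); apply: eq_bigr => i _; rewrite addnC exprD mulrA.
rewrite big_split /= [X in X + _]big_ord_recl /= big_pred0 // add0r.
rewrite [X in _ + X](exchange_big_dep predT) //= -big_split big1 //= => j _.
rewrite [X in _ + X]big_mkcond [X in _ + X]big_ord_recr /=.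
rewrite ltn_ord addr0 -big_mkcond /= /bump /=.
rewrite [X in X + _](eq_bigl (fun i : 'I_n.+2 => ~~ (j < i)%N)); last first.
  by move=> i; rewrite /= add1n ltnS leqNgt.
rewrite -big_split big1 //= => i hij.
rewrite add1n addnS exprS mulN1r (gE i j.+1); last first.
  by rewrite ltnS leqNgt hij ltnS -ltnS ltn_ord.
by rewrite /= addnC mulNr addNr.
Qed.

Lemma coboundaries_cocycles n (c : cochain k X n) :
  c \in coboundaries k X n -> c \in cocycles k X n.
Proof.
case: n c => [|n] c; first by move=> /eqP->; exact: rpred0.
move=> /asboolP[b hb ->]; apply/asboolP; split.
  exact: cobound_normalized.
exact: cobound_cobound.
Qed.

Definition xcast m n (e : m = n) (x : X m) : X n := ecast l (X l) e x.

Lemma xcastE m n (e e' : m = n) (x : X m) : xcast e x = xcast e' x.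
Proof. by rewrite (eq_irrelevance e e'). Qed.

Lemma xcast_id m (e : m = m) (x : X m) : xcast e x = x.
Proof. by rewrite (eq_irrelevance e erefl). Qed.

Lemma xcast_comp m n l (e : m = n) (e' : n = l) (e'' : m = l) (x : X m) :
  xcast e' (xcast e x) = xcast e'' x.
Proof. by case: _ / e' e'' => e''; rewrite xcast_id; exact: xcastE. Qed.

Lemma face_xcast m n i (e : m.+1 = n.+1) (e' : m = n) (x : X m.+1) :
  face i (xcast e x) = xcast e' (face i x).
Proof. by case: _ / e' e => e; rewrite !xcast_id. Qed.

Lemma degen_xcast m n i (e : m.+1 = n.+1) (e' : m = n) (x : X m) :
  degen i (xcast e' x) = xcast e (degen i x).
Proof. by case: _ / e' e => e; rewrite !xcast_id. Qed.

Lemma frontr_face_lo m n i (e : ((n + m).+1 = n + m.+1)%N) (z : X (n + m).+1) :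
  (i <= m.+1)%N -> frontr (face i z) = face i (frontr (n := n) (xcast e z)).
Proof.
move=> hi; elim: n e z => [|n IH] e z /=; first by rewrite xcast_id.
have e' : (n + m).+1 = (n + m.+1)%N by rewrite addnS.
rewrite (face_xcast _ e e') -IH //.
have -> : (n + m.+1).+1 = (n + m).+2 by rewrite addnS.
by rewrite [in RHS]face_face // leqnn andbT (leq_ltn_trans hi) //
  !ltnS leq_addl.
Qed.

Lemma frontr_face_hi m n i (z : X (n + m).+1) : (m < i <= (n + m).+1)%N ->
  frontr (n := n) (face i z) = frontr (n := n) (face (n + m).+1 z).
Proof.
elim: n i z => [|n IH] i z /= /andP[hm hi].
  by congr face; apply/eqP; rewrite eqn_leq hi hm.
move: hi; rewrite leq_eqVlt => /predU1P[-> //|]; rewrite ltnS => hi.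
by rewrite -[RHS](IH i) ?hm // [in RHS]face_face // ltnS hi leqnn.
Qed.

Lemma front_face_lo m n i (z : X (m + n).+1) : (i <= m.+1)%N ->
  front (face i z) = face i (front (m := m.+1) (n := n) z).
Proof.
move=> hi; rewrite /front.
have e : (m + n).+1 = (n + m).+1 by rewrite addnC.
have e1 : ((n + m).+1 = n + m.+1)%N by rewrite addnS.
rewrite -/(xcast _ _) -(face_xcast i e) (frontr_face_lo e1) //.
by congr (face _ (frontr _)); apply: xcast_comp.
Qed.

Lemma front_face_hi m n i (e : (m + n).+1 = (m + n.+1)%N) (z : X (m + n).+1) :
  (m < i <= (m + n).+1)%N ->
  front (face i z) = front (m := m) (n := n.+1) (xcast e z).
Proof.
move=> hi; rewrite /front -!/(xcast _ _).
have e1 : (m + n).+1 = (n + m).+1 by rewrite addnC.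
rewrite -(face_xcast i e1) frontr_face_hi /=; last by rewrite (addnC n).
by congr (frontr (face _ _)); apply/esym/xcast_comp.
Qed.

Lemma back_face_lo m n i (z : X (m + n).+1) : (i <= m)%N ->
  back (face i z) = back (m := m.+1) (n := n) z.
Proof.
elim: m i z => [|m IH] [|i] z //= hi.
rewrite [in LHS]face_face ?IH //.
exact: leq_trans hi (leq_trans (leq_addr n _) (leqnSn _)).
Qed.

Lemma back_face_hi m n i (e : (m + n).+1 = (m + n.+1)%N) (z : X (m + n).+1) :
  (i <= n.+1)%N ->
  back (face (m + i) z) = face i (back (m := m) (n := n.+1) (xcast e z)).
Proof.
elim: m e z => [|m IH] e z hi /=; first by rewrite xcast_id.
have e' : (m + n).+1 = (m + n.+1)%N by rewrite addnS.
rewrite (face_xcast _ e e') -IH // [in LHS](@face_face X _ 0 (m + i).+1) //.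
by rewrite /= ltnS -addnS leq_add2l.
Qed.

Lemma leibniz_cup m n (c : cochain k X m) (c' : cochain k X n)
    (e : (m + n).+1 = (m + n.+1)%N) (z : X (m + n).+1) :
  cobound (cup c c') z = cup (m := m.+1) (cobound c) c' z
    + (-1) ^+ m * cup c (cobound c') (xcast e z).
Proof.
rewrite /cobound /cup.
set w := xcast e z.
have -> : (m + n).+2 = (m.+1 + n.+1)%N by rewrite addSn addnS.
rewrite big_split_ord /= [X in _ = X * _ + _]big_ord_recr.
rewrite [X in _ = _ + _ * (_ * X)]big_ord_recl /= mulrDl mulrDr mulrDr.
have hi : face m.+1 (front (m := m.+1) (n := n) z) = front w.
  rewrite -front_face_lo // (front_face_hi e) //.
  by rewrite ltnSn ltnS leq_addr.
have h0 : face 0 (back w) = back (m := m.+1) (n := n) z.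
  by rewrite /w -back_face_hi // addn0 back_face_lo.
rewrite hi h0 expr0 mul1r exprS mulN1r -[back (face 0 z)]/(back (m := m.+1) z).
have aux (S1 S2 T1 T2 p a b : k) : S1 = T1 -> S2 = T2 ->
    S1 + S2 = T1 + (- p) * a * b + (p * (a * b) + T2) by move=> -> ->; ring.
apply: aux.
  rewrite mulr_suml; apply: eq_bigr => i _; have hi' := ltn_ord i.
  by rewrite front_face_lo ?(ltnW hi') // back_face_lo // mulrA.
rewrite !mulr_sumr; apply: eq_bigr => i _ /=; have hi' := ltn_ord i.
have -> : (m.+1 + i = m + i.+1)%N by rewrite addnS.
rewrite (back_face_hi e) // (front_face_hi e); last first.
  by rewrite addnS ltnS leq_addr -addnS -[X in (_ <= X)%N]addnS leq_add2l.
by rewrite /bump /= add1n exprD; ring.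
Qed.

End CohomologyTheory.

Section CupTheory.
Variables (k : fieldType) (X : sset).

Lemma frontr_degen_lo m n i (e : (n + m).+1 = (n + m.+1)%N) (x : X (n + m)) :
  (i <= m)%N ->
  frontr (n := n) (xcast e (degen i x)) = degen i (frontr (n := n) x).
Proof.
move=> hi; elim: n e x => [|n IH] e x /=; first by rewrite xcast_id.
have e' : (n + m).+1 = (n + m.+1)%N by rewrite addnS.
have -> : (n + m.+1).+1 = (n + m).+2 by rewrite addnS.
rewrite (face_xcast _ e e') [in LHS]face_degen_gt ?IH //.
by rewrite leqnn andbT !ltnS (leq_trans hi) // leq_addl.
Qed.

Lemma front_degen_lo m n i (x : X (m + n)) : (i <= m)%N ->
  front (m := m.+1) (n := n) (degen i x) = degen i (front x).
Proof.
move=> hi; rewrite /front -!/(xcast _ _).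
have e1 : (n + m).+1 = (n + m.+1)%N by rewrite addnS.
rewrite -(frontr_degen_lo e1) //.
have e2 : (m + n).+1 = (n + m).+1 by rewrite addnC.
by rewrite (degen_xcast i e2) (xcast_comp _ _ (addnC m.+1 n)).
Qed.

Lemma back_degen_hi m n i (e : (m + n).+1 = (m + n.+1)%N) (x : X (m + n)) :
  (i <= n)%N ->
  back (m := m) (n := n.+1) (xcast e (degen (m + i) x)) = degen i (back x).
Proof.
elim: m e x => [|m IH] e x hi /=; first by rewrite xcast_id.
have e' : (m + n).+1 = (m + n.+1)%N by rewrite addnS.
rewrite (face_xcast _ e e') [in LHS]face_degen_lt ?IH //.
by rewrite /= ltnS leq_add2l.
Qed.

Lemma cup_normalized m n (c : cochain k X m) (c' : cochain k X n) :
  normalized c -> normalized c' -> normalized (cup c c').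
Proof.
case: m c => [|m] c hc hc'; first case: n c' hc' => [|n] c' hc' //= i x hi.
  by rewrite /cup /= hc' ?mulr0.
move=> /= i x hi; rewrite /cup.
case: (leqP i m) => him; first by rewrite front_degen_lo // hc ?mul0r.
case: n c' hc' x hi => [|n] c' hc' x hi.
  by rewrite addn0 in hi; rewrite leqNgt him in hi.
have e : (m + n.+1 = m.+1 + n)%N by rewrite addnS.
have e1 : (m.+1 + n).+1 = (m.+1 + n.+1)%N by rewrite addnS.
rewrite -[x](xcast_comp e (esym e) erefl).
rewrite (degen_xcast i e1 (esym e)) -(subnKC him) back_degen_hi ?hc' ?mulr0 //;
  by rewrite leq_subLR addSn -addnS.
Qed.

Lemma cocyclesP n (c : cochain k X n) :
  reflect (normalized c /\ cobound c = 0) (c \in cocycles k X n).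
Proof. exact: asboolP. Qed.

Lemma cup_cocycles m n c c' : c \in cocycles k X m -> c' \in cocycles k X n ->
  cup c c' \in cocycles k X (m + n).
Proof.
move=> /cocyclesP[hc dc] /cocyclesP[hc' dc']; apply/cocyclesP; split.
  exact: cup_normalized.
apply/funext=> z; rewrite leibniz_cup ?addnS // => e.
rewrite dc dc' /cup [X in X * _]/(0 : k) [X in _ * (_ * X)]/(0 : k).
by rewrite mul0r !mulr0 addr0.
Qed.

Lemma coboundaries_xcast m n (e : m.+1 = n) (b : cochain k X m)
    (c : cochain k X n) :
  normalized b -> (forall z, c (xcast e z) = cobound b z) ->
  c \in coboundaries k X n.
Proof.
case: _ / e c => c hb h; apply/asboolP; exists b => //.
by apply/funext=> z; rewrite -h.
Qed.

Lemma cup_coboundaryl m n c c' : c \in coboundaries k X m ->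
  c' \in cocycles k X n -> cup c c' \in coboundaries k X (m + n).
Proof.
case: m c => [|m] c; first move=> /eqP-> _.
  rewrite (_ : cup _ _ = 0) ?rpred0 //; apply/funext=> x.
  by rewrite /cup [X in X * _]/(0 : k) mul0r.
move=> /asboolP[b hb ->] /cocyclesP[hc' dc']; apply/asboolP.
exists (cup b c'); first exact: cup_normalized.
apply/funext=> z; rewrite leibniz_cup ?addnS // => e.
by rewrite dc' /cup [X in _ * (_ * X)]/(0 : k) !mulr0 addr0.
Qed.

Lemma cup_coboundaryr m n c c' : c \in cocycles k X m ->
  c' \in coboundaries k X n -> cup c c' \in coboundaries k X (m + n).
Proof.
move=> /cocyclesP[hc dc]; case: n c' => [|n] c'; first move=> /eqP->.
  rewrite (_ : cup _ _ = 0) ?rpred0 //; apply/funext=> x.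
  by rewrite /cup [X in _ * X]/(0 : k) mulr0.
move=> /asboolP[b hb ->].
have e : (m + n).+1 = (m + n.+1)%N by rewrite addnS.
suff : (-1) ^+ m *: cup c (cobound b) \in coboundaries k X (m + n.+1).
  by rewrite rpredZeq signr_eq0.
apply: (coboundaries_xcast (e := e) (b := cup c b)).
  exact: cup_normalized.
move=> z; rewrite (leibniz_cup _ _ e) dc /cup [X in X * _ + _]/(0 : k).
by rewrite mul0r add0r.
Qed.

Lemma hcupE m n c c' : c \in cocycles k X m -> c' \in cocycles k X n ->
  hcup (cls _ (coboundaries k X m) c) (cls _ (coboundaries k X n) c')
  = cls _ (coboundaries k X (m + n)) (cup c c').
Proof.
move=> hc hc'; have hd := cls_rep (coboundaries k X m) hc.
have hd' := cls_rep (coboundaries k X n) hc'.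
set u := rep _ in hd; set v := rep _ in hd'.
have hu : u \in cocycles k X m := rep_in _.
have hv : v \in cocycles k X n := rep_in _.
apply/clsP; [exact: cup_cocycles | exact: cup_cocycles | ].
have -> : cup u v - cup c c' = cup (u - c) v + cup c (v - c').
  apply/funext=> x; rewrite -[LHS]/(u _ * v _ - c _ * c' _).
  rewrite -[RHS]/((u _ - c _) * v _ + c _ * (v _ - c' _)); ring.
by apply: rpredD; [exact: cup_coboundaryl | exact: cup_coboundaryr].
Qed.

End CupTheory.


Section Pullback.
Variables (k : fieldType) (X Y : sset) (f : sset_map X Y).

Definition pull n (c : cochain k Y n) : cochain k X n := fun x => c (f n x).

Definition hmap n (a : cohomology k Y n) : cohomology k X n :=
  cls _ _ (pull (rep a)).

Lemma pull_normalized n (c : cochain k Y n) :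
  normalized c -> normalized (pull c).
Proof. by case: n c => //= n c hc i x hi; rewrite /pull smap_degen // hc. Qed.

Lemma pull_cobound n (c : cochain k Y n) : pull (cobound c) = cobound (pull c).
Proof.
apply/funext=> x; apply: eq_bigr => i _; rewrite /pull smap_face //.
by rewrite -ltnS ltn_ord.
Qed.

Lemma pull_cocycles n c : c \in cocycles k Y n -> pull c \in cocycles k X n.
Proof.
move=> /cocyclesP[hc dc]; apply/cocyclesP; split; first exact: pull_normalized.
by rewrite -pull_cobound dc.
Qed.

Lemma pull_coboundaries n c :
  c \in coboundaries k Y n -> pull c \in coboundaries k X n.
Proof.
case: n c => [|n] c; first by move=> /eqP->; exact: rpred0.
move=> /asboolP[b hb ->]; apply/asboolP; exists (pull b).
  exact: pull_normalized.
exact: pull_cobound.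
Qed.

Lemma hmapE n c : c \in cocycles k Y n ->
  hmap (cls _ (coboundaries k Y n) c)
  = cls _ (coboundaries k X n) (pull c).
Proof.
move=> hc; apply/clsP; try by apply: pull_cocycles; rewrite ?rep_in.
exact: (pull_coboundaries (cls_rep (coboundaries k Y n) hc)).
Qed.

End Pullback.

Record left_action (G : finGroupType) (F : Type) := LeftAction {
  act :> G -> F -> F;
  act1 : forall y, act 1%g y = y;
  actM : forall g h y, act (g * h)%g y = act g (act h y)
}.

Section AugmentationFiltration.
Variables (k : fieldType) (G : finGroupType).

(* Elements of k[G] and k[F] are given by their coefficient functions. *)
Definition gmul (u v : {ffun G -> k^o}) : {ffun G -> k^o} :=
  [ffun g => \sum_h u h * v (h^-1 * g)%g].

Definition augmentation (u : {ffun G -> k^o}) : k := \sum_g u g.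

Fixpoint aug_pow (n : nat) : {ffun G -> k^o} -> Prop :=
  match n with
  | 0 => fun=> True
  | m.+1 => span (fun w => exists u v,
      [/\ augmentation u = 0, aug_pow m v & w = gmul u v])
  end.

Definition aug_nilpotent : Prop := exists n, forall u, aug_pow n u -> u = 0.

Variables (F : finType) (A : left_action G F).

Definition gact (u : {ffun G -> k^o}) (m : {ffun F -> k^o}) :
    {ffun F -> k^o} :=
  [ffun y => \sum_g u g * m (A g^-1%g y)].

Definition aug_pow_act (n : nat) : {ffun F -> k^o} -> Prop :=
  span (fun m => exists u m', aug_pow n u /\ m = gact u m').

Definition eval (c : F -> k^o) (m : {ffun F -> k^o}) : k := \sum_y m y * c y.

(* F^q is the annihilator of a^(p+1) k[F] for q = -p <= 0, and 0 for q > 0. *)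
Definition ffilt (q : int) : {pred F -> k^o} := fun c =>
  if q <= 0
  then `[< forall m, aug_pow_act (absz q).+1 m -> eval c m = 0 >]
  else c == 0.

Fact ffilt_closed q : submod_closed (ffilt q).
Proof.
rewrite /ffilt; split=> [|a c c'].
  rewrite -topredE /=; case: ifP => _ //; apply/asboolP => m _.
  by rewrite /eval big1 // => y _; rewrite mulr0.
rewrite -!topredE /=; case: ifP => _; last first.
  by move=> /eqP-> /eqP->; rewrite scaler0 addr0.
move=> /asboolP h /asboolP h'; apply/asboolP => m hm.
transitivity (a * eval c m + eval c' m); last by rewrite h // h' // mulr0 addr0.
rewrite /eval mulr_sumr -big_split; apply: eq_bigr => y _ /=.
by rewrite -[(a *: c + c') y]/(a * c y + c' y) mulrDr mulrCA.
Qed.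
HB.instance Definition _ q :=
  GRing.isSubmodClosed.Build k (F -> k^o) (ffilt q) (ffilt_closed q).

Definition fgr (q : int) : lmodType k := subquo (ffilt q) (ffilt (q + 1)).

Definition fgr_mul p q (a : fgr p) (b : fgr q) : fgr (p + q) :=
  cls _ _ (rep a * rep b).

End AugmentationFiltration.

Definition fgr_map (k : fieldType) (G G' : finGroupType) (F F' : finType)
    (A : left_action G F) (A' : left_action G' F') (h : F -> F') q
    (a : fgr k A' q) : fgr k A q :=
  cls _ _ (rep a \o h).

Section FiltrationTheory.
Variables (k : fieldType) (G : finGroupType) (F : finType).
Variable A : left_action G F.
Implicit Types c : F -> k^o.

Lemma evalD (c : F -> k^o) a m m' :
  eval c (a *: m + m') = a * eval c m + eval c m'.
Proof.
rewrite /eval mulr_sumr -big_split; apply: eq_bigr => y _ /=.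
by rewrite !ffunE -[a *: m y]/(a * m y) mulrDl mulrA.
Qed.

Lemma eval0 (c : F -> k^o) : eval c 0 = 0.
Proof. by rewrite /eval big1 // => y _; rewrite ffunE mul0r. Qed.

Lemma eval_span (c : F -> k^o) S m :
  (forall v, S v -> eval c v = 0) -> span S m -> eval c m = 0.
Proof.
move=> h; elim=> [|a u v hu _ hv]; first exact: eval0.
by rewrite evalD h // hv mulr0 addr0.
Qed.

Lemma gact_mul (u v : {ffun G -> k^o}) (m : {ffun F -> k^o}) :
  gact A (gmul u v) m = gact A u (gact A v m).
Proof.
apply/ffunP=> y; rewrite !ffunE.
under eq_bigr => g _ do rewrite ffunE mulr_suml.
rewrite exchange_big; apply: eq_bigr => h _ /=.
rewrite ffunE mulr_sumr (reindex_inj (mulgI h)); apply: eq_bigr => g _ /=.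
by rewrite mulKg invMg actM mulrA.
Qed.

Lemma gactD (a : k) (u v : {ffun G -> k^o}) m :
  gact A (a *: u + v) m = a *: gact A u m + gact A v m.
Proof.
apply/ffunP=> y; rewrite !ffunE.
rewrite -[RHS]/(a * (\sum_g u g * m (A g^-1%g y))
  + \sum_g v g * m (A g^-1%g y)).
rewrite mulr_sumr -big_split; apply: eq_bigr => g _ /=.
by rewrite !ffunE -[a *: u g]/(a * u g) mulrDl mulrA.
Qed.

Lemma gact0 m : gact A (0 : {ffun G -> k^o}) m = 0.
Proof.
by apply/ffunP=> y; rewrite !ffunE big1 // => g _; rewrite ffunE mul0r.
Qed.

Definition translate (c : F -> k^o) (g : G) : F -> k^o := fun y => c (A g y).

Lemma eval_gact (c : F -> k^o) u m :
  eval c (gact A u m) = \sum_g u g * eval (translate c g) m.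
Proof.
rewrite /eval; under eq_bigr => y _ do rewrite ffunE mulr_suml.
rewrite exchange_big; apply: eq_bigr => g _ /=.
have inj : injective (A g).
  by apply: (can_inj (g := A g^-1%g)) => y; rewrite -actM mulVg act1.
rewrite mulr_sumr (reindex_inj inj); apply: eq_bigr => y _ /=.
by rewrite -actM mulVg act1 mulrA.
Qed.

Lemma aug_powS n (u : {ffun G -> k^o}) : aug_pow n.+1 u -> aug_pow n u.
Proof.
elim: n u => [|n IH] u //=; elim=> [|a w v [u' [v' [h h' ->]]] _ hv].
  exact: span0.
by apply: spanD hv; exists u', v'; split => //; apply: IH.
Qed.

Lemma aug_pow_actS n (m : {ffun F -> k^o}) :
  aug_pow_act A n.+1 m -> aug_pow_act A n m.
Proof.
elim=> [|a w v [u [m' [h ->]]] _ hv]; first exact: span0.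
by apply: spanD hv; exists u, m'; split => //; apply: aug_powS.
Qed.

Definition kills p (c : F -> k^o) : Prop :=
  forall m, aug_pow_act A p m -> eval c m = 0.

Lemma killsS p c : kills p c -> kills p.+1 c.
Proof. by move=> h m hm; apply/h/aug_pow_actS. Qed.

Lemma eval_fun0 m : eval (0 : F -> k^o) m = 0.
Proof. by rewrite /eval big1 // => y _; rewrite mulr0. Qed.

Lemma eval_funD a (c c' : F -> k^o) m :
  eval (a *: c + c') m = a * eval c m + eval c' m.
Proof.
rewrite /eval mulr_sumr -big_split; apply: eq_bigr => y _ /=.
by rewrite -[(a *: c + c') y]/(a * c y + c' y) mulrDr mulrCA.
Qed.

Lemma eval_funB (c c' : F -> k^o) m : eval (c - c') m = eval c m - eval c' m.
Proof.
by rewrite addrC -scaleN1r eval_funD mulN1r addrC.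
Qed.

Lemma kills_zero p : kills p 0.
Proof. by move=> m _; exact: eval_fun0. Qed.

Lemma killsD p c c' : kills p c -> kills p c' -> kills p (c + c').
Proof.
by move=> h h' m hm; rewrite -[c]scale1r eval_funD h // h' // mulr0 addr0.
Qed.

Lemma kills0 c : kills 0 c -> c = 0.
Proof.
move=> h; apply/funext=> y.
pose m : {ffun F -> k^o} := [ffun z => (z == y)%:R].
have : eval c m = 0.
  apply: h; rewrite -[m]addr0 -[m]scale1r; apply: spanD; last exact: span0.
  pose u : {ffun G -> k^o} := [ffun g => (g == 1%g)%:R].
  exists u, m; split=> //; apply/ffunP=> z; rewrite ffunE [RHS]ffunE.
  rewrite (bigD1 1%g) //= big1 ?addr0 => [|g /negPf hg].
    by rewrite !ffunE eqxx mul1r invg1 act1.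
  by rewrite ffunE hg mul0r.
rewrite /eval (bigD1 y) //= big1 ?addr0 => [|z /negPf hz].
  by rewrite ffunE eqxx mul1r.
by rewrite ffunE hz mul0r.
Qed.

Lemma kills_succP p c : kills p.+1 c <-> forall g, kills p (translate c g - c).
Proof.
split=> [h g m hm | h m].
  apply: eval_span hm => _ [v [m' [hv ->]]].
  pose d (x : G) : {ffun G -> k^o} := [ffun y => (y == x)%:R].
  pose u := d g - d 1%g.
  have sumd x (f : G -> k) : \sum_y d x y * f y = f x.
    rewrite (bigD1 x) //= big1 ?addr0 => [|y /negPf hy].
      by rewrite ffunE eqxx mul1r.
    by rewrite ffunE hy mul0r.
  have sumu (f : G -> k) : \sum_y u y * f y = f g - f 1%g.
    rewrite -!sumd -sumrB; apply: eq_bigr => y _.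
    by rewrite -mulrBl !ffunE.
  transitivity (eval c (gact A u (gact A v m'))).
    rewrite [RHS]eval_gact (sumu (fun x => eval (translate c x) _)) eval_funB.
    by congr (_ - eval _ _); apply/funext=> y; rewrite /translate act1.
  rewrite -gact_mul; apply: h; rewrite -[gact _ _ _]addr0 -[gact _ _ _]scale1r.
  apply: spanD; last exact: span0.
  exists (gmul u v), m'; split=> //=.
  rewrite -[gmul _ _]addr0 -[gmul _ _]scale1r; apply: spanD; last exact: span0.
  exists u, v; split=> //; rewrite /augmentation.
  by under eq_bigr => y _ do rewrite -[u y]mulr1; rewrite sumu subrr.
apply: eval_span => _ [u [m' [hu ->]]].
elim: hu => [|a w v [u' [v' [hu' hv' ->]]] _ hv]; first by rewrite gact0 eval0.
rewrite gactD evalD hv addr0 gact_mul eval_gact.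
transitivity (a * \sum_g u' g * eval (translate c g - c) (gact A v' m')).
  congr (_ * _); under [in RHS]eq_bigr => g _ do rewrite eval_funB mulrBr.
  by rewrite sumrB -mulr_suml -/(augmentation u') hu' mul0r subr0.
rewrite big1 ?mulr0 // => g _; rewrite h ?mulr0 //.
rewrite -[gact _ _ _]addr0 -[gact _ _ _]scale1r.
by apply: spanD; [exists v', m' | exact: span0].
Qed.

Lemma kills_translate p c g : kills p c -> kills p (translate c g).
Proof.
case: p => [|p] h; first by rewrite (kills0 h); exact: kills_zero.
rewrite -[translate c g](subrK c); apply: killsD => //.
by apply: killsS; move/kills_succP: h.
Qed.

Lemma kills_mul p q c c' :
  kills p.+1 c -> kills q.+1 c' -> kills (p + q).+1 (c * c').
Proof.
move: {2}(p + q)%N (leqnn (p + q)) => n.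
elim: n p q c c' => [|n IH] p q c c' hn h h';
  apply/kills_succP => g.
all: have -> : translate (c * c') g - c * c' =
    (translate c g - c) * translate c' g + c * (translate c' g - c')
  by apply/funext=> y; rewrite /translate;
     rewrite -[LHS]/(c (A g y) * c' (A g y) - c y * c' y);
     rewrite -[RHS]/((c (A g y) - c y) * c' (A g y)
       + c y * (c' (A g y) - c' y)); ring.
all: move/kills_succP: (h) => /(_ g) hg; move/kills_succP: (h') => /(_ g) hg'.
all: have h'g : kills q.+1 (translate c' g) by apply: kills_translate.
  case: p q hn h h' hg hg' h'g => [|//] [|//] _ h h' hg hg' h'g.
  by rewrite (kills0 hg) (kills0 hg') mul0r mulr0 addr0; exact: kills_zero.
apply: killsD.
  case: p hn h hg => [|p] hn h hg.
    by rewrite (kills0 hg) mul0r; exact: kills_zero.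
  by rewrite addSn; apply: IH.
case: q hn h' hg' h'g => [|q] hn h' hg' h'g.
  by rewrite (kills0 hg') mulr0; exact: kills_zero.
by rewrite addnS; apply: IH => //; rewrite addnS in hn.
Qed.

Lemma ffiltP (q : int) c :
  reflect (if q <= 0 then kills (absz q).+1 c else c = 0) (c \in ffilt A q).
Proof.
rewrite -[c \in _]topredE /= /ffilt.
by case: ifP => _; [exact: asboolP | exact: eqP].
Qed.

Lemma ffilt_decr (q : int) c : c \in ffilt A (q + 1) -> c \in ffilt A q.
Proof.
move=> /ffiltP h; apply/ffiltP; case: (leP q 0) => hq; last first.
  by move: h; rewrite leNgt ltr_wpDr.
move: h; case: ifP => h1; last by move=> ->; exact: kills_zero.
have -> : absz q = (absz (q + 1)%R).+1 by lia.
exact: killsS.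
Qed.

Lemma ffilt_mul (p q : int) c c' :
  c \in ffilt A p -> c' \in ffilt A q -> c * c' \in ffilt A (p + q).
Proof.
move=> /ffiltP h /ffiltP h'.
case: (leP p 0) h => [hp h|_ ->]; last by rewrite mul0r rpred0.
case: (leP q 0) h' => [hq h'|_ ->]; last by rewrite mulr0 rpred0.
apply/ffiltP; have -> : p + q <= 0 by lia.
have -> : absz (p + q)%R = (absz p + absz q)%N by lia.
exact: kills_mul.
Qed.

Lemma fgr_mulE (p q : int) c c' : c \in ffilt A p -> c' \in ffilt A q ->
  fgr_mul (cls _ (ffilt A (p + 1)) c) (cls _ (ffilt A (q + 1)) c')
  = cls _ (ffilt A (p + q + 1)) (c * c').
Proof.
move=> hc hc'; have hd := cls_rep (ffilt A (p + 1)) hc.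
have hd' := cls_rep (ffilt A (q + 1)) hc'.
set u := rep _ in hd; set v := rep _ in hd'.
have hu : u \in ffilt A p := rep_in _.
have hv : v \in ffilt A q := rep_in _.
apply/clsP; [exact: ffilt_mul | exact: ffilt_mul | ].
have -> : u * v - c * c' = (u - c) * v + c * (v - c').
  by rewrite mulrBl mulrBr addrA subrK.
apply: rpredD; last by rewrite -addrA; exact: ffilt_mul.
by rewrite addrAC; exact: ffilt_mul.
Qed.

End FiltrationTheory.

Section FiltrationMap.
Variables (k : fieldType) (G G' : finGroupType) (F F' : finType).
Variables (A : left_action G F) (A' : left_action G' F').
Variables (al : G -> G') (h : F -> F').
Hypothesis hA : forall g y, h (A g y) = A' (al g) (h y).

Lemma kills_map p (c : F' -> k^o) : kills A' p c -> kills A p (c \o h).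
Proof.
elim: p c => [|p IH] c hc; first by rewrite (kills0 hc); exact: kills_zero.
apply/kills_succP => g.
have -> : translate A (c \o h) g - (c \o h) = (translate A' c (al g) - c) \o h.
  apply/funext=> y; rewrite -[LHS]/(c (h (A g y)) - c (h y)) hA //.
by apply: IH; move/kills_succP: hc.
Qed.

Lemma ffilt_map q (c : F' -> k^o) : c \in ffilt A' q -> c \o h \in ffilt A q.
Proof.
move=> /ffiltP hc; apply/ffiltP; case: ifP hc => _; first exact: kills_map.
by move=> ->.
Qed.

Lemma fgr_mapE q (c : F' -> k^o) : c \in ffilt A' q ->
  fgr_map A h (cls _ (ffilt A' (q + 1)) c) = cls _ (ffilt A (q + 1)) (c \o h).
Proof.
move=> hc; apply/clsP; try by apply: ffilt_map; rewrite ?rep_in.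
exact: (ffilt_map (cls_rep (ffilt A' (q + 1)) hc)).
Qed.

End FiltrationMap.

Record twisting (X : sset) (G : finGroupType) := Twisting {
  tau :> forall n, X n.+1 -> G;
  tau_face0 : forall n (x : X n.+2),
    tau x = ((tau (face 0 x))^-1 * tau (face 1 x))%g;
  tau_face : forall n i (x : X n.+2), (0 < i < n.+2)%N ->
    tau x = tau (face i.+1 x);
  tau_degen : forall n i (x : X n.+1), (i < n.+1)%N ->
    tau x = tau (degen i.+1 x);
  tau_degen0 : forall n (x : X n), tau (degen 0 x) = 1%g
}.

Section TwistedProduct.
Variables (X : sset) (G : finGroupType) (F : Type).
Variables (t : twisting X G) (A : left_action G F).

Definition tw_face n i (z : X n.+1 * F) : X n * F :=
  (face i z.1, if i == 0%N then A (t n z.1) z.2 else z.2).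

Definition tw_degen n i (z : X n * F) : X n.+1 * F := (degen i z.1, z.2).

Fact tw_face_face n i j (z : X n.+2 * F) : (i < j <= n.+2)%N ->
  tw_face i (tw_face j z) = tw_face j.-1 (tw_face i z).
Proof.
case: z => x y hij; rewrite /tw_face /= face_face //.
case: j hij => [|[|j]] //= hij; case: i hij => [|i] hij //=.
  by rewrite [in RHS](tau_face0 t x) -actM mulgA mulgV mul1g.
by rewrite (@tau_face _ _ t _ j.+1 x).
Qed.

Fact tw_face_degen_lt n i j (z : X n.+1 * F) : (i < j <= n.+1)%N ->
  tw_face i (tw_degen j z) = tw_degen j.-1 (tw_face i z).
Proof.
case: z => x y hij; rewrite /tw_face /tw_degen /= face_degen_lt //.
case: j hij => [|j] //= hij; case: i hij => [|i] hij //=.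
by rewrite -(@tau_degen _ _ t _ j x).
Qed.

Fact tw_face_degen_id n i j (z : X n * F) : (j <= n)%N ->
  (i == j) || (i == j.+1) -> tw_face i (tw_degen j z) = z.
Proof.
case: z => x y hj hij; rewrite /tw_face /tw_degen /= face_degen_id //.
by case: i j hj hij => [|i] [|j] //= hj _; rewrite tau_degen0 act1.
Qed.

Fact tw_face_degen_gt n i j (z : X n.+1 * F) : (j.+1 < i <= n.+2)%N ->
  tw_face i (tw_degen j z) = tw_degen j (tw_face i.-1 z).
Proof.
case: z => x y hij; rewrite /tw_face /tw_degen /= face_degen_gt //.
by case: i hij => [|[|i]].
Qed.

Fact tw_degen_degen n i j (z : X n * F) : (i <= j <= n)%N ->
  tw_degen i (tw_degen j z) = tw_degen j.+1 (tw_degen i z).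
Proof. by case: z => x y hij; rewrite /tw_degen /= degen_degen. Qed.

Definition twisted_product : sset :=
  SSet tw_face_face tw_face_degen_lt tw_face_degen_id tw_face_degen_gt
    tw_degen_degen.

End TwistedProduct.

Section DBGA.
Variable k : fieldType.

(* The second component of a bidegree (p, q) is the filtration degree, and p + q
   is the total degree, so the differential d_r has bidegree (1 - r, r). *)
Definition ddeg (r : nat) : int * int := (1 - r%:Z, r%:Z).

(* Differential bigraded algebras. Structure maps take proofs of the degree
   equations as arguments, so that no transport along these equations is needed;
   such proofs are unique because [int * int] is an eqType. *)
Record dbga (r : nat) := DBGA {
  comp :> int * int -> lmodType k;
  diff : forall a b : int * int, b = a + ddeg r -> {linear comp a -> comp b};
  mul : forall a b c : int * int, a + b = c -> comp a -> comp b -> comp c;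
  one : comp 0;
  diff_diff : forall (a b c : int * int)
      (e : b = a + ddeg r) (e' : c = b + ddeg r) x,
    diff e' (diff e x) = 0;
  mul_bilinear : forall (a b c : int * int) (e : a + b = c),
    bilinear_map (mul e);
  mul_assoc : forall (a b c ab bc abc : int * int)
      (e1 : a + b = ab) (e2 : b + c = bc)
      (e3 : ab + c = abc) (e4 : a + bc = abc) x y z,
    mul e3 (mul e1 x y) z = mul e4 x (mul e2 y z);
  mul_onel : forall (a : int * int) (e : 0 + a = a) x, mul e one x = x;
  mul_oner : forall (a : int * int) (e : a + 0 = a) x, mul e x one = x;
  leibniz : forall (a b c a' b' c' : int * int)
      (e : a + b = c) (ea : a' = a + ddeg r)
      (eb : b' = b + ddeg r) (ec : c' = c + ddeg r)
      (e1 : a' + b = c') (e2 : a + b' = c') x y,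
    diff ec (mul e x y) =
      mul e1 (diff ea x) y + (-1) ^+ absz (a.1 + a.2) *: mul e2 x (diff eb y)
}.

End DBGA.

Arguments diff {k r} d {a b} _.
Arguments mul {k r} d {a b c} _ _ _.
Arguments one {k r} d.

Section Homology.
Variables (k : fieldType) (r : nat) (E : dbga k r) (a : int * int).

Definition cycles : {pred E a} := fun x => diff E (erefl (a + ddeg r)) x == 0.

Definition boundaries : {pred E a} := fun x =>
  `[< exists y : E (a - ddeg r), x = diff E (esym (subrK (ddeg r) a)) y >].

Fact cycles_closed : submod_closed cycles.
Proof.
split=> [|c x y /eqP hx /eqP hy]; first by rewrite -topredE /= /cycles linear0.
by rewrite -topredE /= /cycles linearP hx hy scaler0 addr0.
Qed.
HB.instance Definition _ :=
  GRing.isSubmodClosed.Build k (E a) cycles cycles_closed.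

Fact boundaries_closed : submod_closed boundaries.
Proof.
split=> [|c x y /asboolP[x' ->] /asboolP[y' ->]]; apply/asboolP.
  by exists 0; rewrite linear0.
by exists (c *: x' + y'); rewrite linearP.
Qed.
HB.instance Definition _ :=
  GRing.isSubmodClosed.Build k (E a) boundaries boundaries_closed.

Definition homology : lmodType k := subquo cycles boundaries.

End Homology.

Arguments cycles {k r} E a.
Arguments boundaries {k r} E a.
Arguments homology {k r} E a.

Section SpectralSequence.
Variable k : fieldType.

(* The pages are E_1, E_2, ...; nothing is required of page 0. *)
Record spectral_sequence := SpectralSequence {
  page :> forall r, dbga k r;
  turn : forall r a, {linear homology (page r) a -> page r.+1 a};
  turn_bij : forall r a, (0 < r)%N -> bijective (turn r a);
  turn_mul : forall r (a b c : int * int) (e : a + b = c) x y, (0 < r)%N ->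
    x \in cycles (page r) a -> y \in cycles (page r) b ->
    turn r c (cls _ _ (mul (page r) e x y)) =
      mul (page r.+1) e (turn r a (cls _ _ x)) (turn r b (cls _ _ y));
  turn_one : forall r, (0 < r)%N ->
    turn r 0 (cls _ _ (one (page r))) = one (page r.+1)
}.

Record ss_map (E E' : spectral_sequence) := SSMap {
  pmap :> forall r a, {linear E r a -> E' r a};
  pmap_diff : forall r (a b : int * int) (e : b = a + ddeg r) x, (0 < r)%N ->
    pmap r b (diff (E r) e x) = diff (E' r) e (pmap r a x);
  pmap_mul : forall r (a b c : int * int) (e : a + b = c) x y, (0 < r)%N ->
    pmap r c (mul (E r) e x y) = mul (E' r) e (pmap r a x) (pmap r b y);
  pmap_one : forall r, (0 < r)%N -> pmap r 0 (one (E r)) = one (E' r);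
  pmap_turn : forall r a x, (0 < r)%N -> x \in cycles (E r) a ->
    pmap r.+1 a (turn E r a (cls _ _ x)) =
      turn E' r a (cls _ _ (pmap r a x))
}.

(* Convergence, as algebras, to H^*(Y) with a filtration that is finite in each
   degree. Near each bidegree the differentials vanish from page [stable] on, so
   that [page r a], for r >= stable a, is E_infinity; [edge] identifies it with
   the associated graded of H^*(Y), compatibly with the identifications [turn]
   of the stable pages. *)
Record convergence (E : spectral_sequence) (Y : sset) := Convergence {
  fil : int -> forall n, submodClosed (cohomology k Y n);
  fil_decr : forall q n x, x \in fil (q + 1) n -> x \in fil q n;
  fil_exhaustive : forall n, exists q, forall x, x \in fil q n;
  fil_separated : forall n, exists q, forall x, x \in fil q n -> x = 0;
  fil_mul : forall p q m n x y, x \in fil p m -> y \in fil q n ->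
    hcup x y \in fil (p + q) (m + n);
  stable : int * int -> nat;
  stable_gt0 : forall a, (0 < stable a)%N;
  stable_out : forall r (a b : int * int) (e : b = a + ddeg r) (x : E r a),
    (stable a <= r)%N -> diff (E r) e x = 0;
  stable_in : forall r (a b : int * int) (e : b = a + ddeg r) (x : E r a),
    (stable b <= r)%N -> diff (E r) e x = 0;
  edge : forall r (a : int * int) n, a.1 + a.2 = n%:Z ->
    {linear E r a -> subquo (fil a.2 n) (fil (a.2 + 1) n)};
  edge_bij : forall r (a : int * int) n (e : a.1 + a.2 = n%:Z),
    (stable a <= r)%N -> bijective (edge r e);
  edge_neg : forall r a (x : E r a),
    (stable a <= r)%N -> a.1 + a.2 < 0 -> x = 0;
  edge_turn : forall r (a : int * int) n (e : a.1 + a.2 = n%:Z) x,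
    (stable a <= r)%N -> edge r.+1 e (turn E r a (cls _ _ x)) = edge r e x;
  edge_mul : forall r (a b : int * int) m n
      (ea : a.1 + a.2 = m%:Z) (eb : b.1 + b.2 = n%:Z)
      (eab : (a + b).1 + (a + b).2 = (m + n)%:Z) x y,
    (stable a <= r)%N -> (stable b <= r)%N -> (stable (a + b)%R <= r)%N ->
    edge r eab (mul (E r) (erefl (a + b)) x y) =
      cls _ _ (hcup (rep (edge r ea x)) (rep (edge r eb y)))
}.

End SpectralSequence.

Section Main.
Variable k : fieldType.

(* [tens] exhibits E_1^{p,q} as the tensor product of H^{p+q}(X) and gr^q(F); as
   [cohomology] is indexed by [nat], negative total degrees are separate. *)
Record first_page (X : sset) (G : finGroupType) (F : finType)
    (A : left_action G F) (E : spectral_sequence k) := FirstPage {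
  tens : forall (a : int * int) n, a.1 + a.2 = n%:Z ->
    cohomology k X n -> fgr k A a.2 -> E 1%N a;
  tens_tensor : forall (a : int * int) n (e : a.1 + a.2 = n%:Z),
    is_tensor_product (tens e);
  tens_neg : forall a (x : E 1%N a), a.1 + a.2 < 0 -> x = 0;
  tens_mul : forall (a b : int * int) m n
      (ea : a.1 + a.2 = m%:Z) (eb : b.1 + b.2 = n%:Z)
      (eab : (a + b).1 + (a + b).2 = (m + n)%:Z) x y u v,
    mul (E 1%N) (erefl (a + b)) (tens ea x u) (tens eb y v) =
      tens eab (hcup x y) (fgr_mul u v)
}.

Record twisted_data := TwistedData {
  td_X : sset;
  td_G : finGroupType;
  td_F : finType;
  td_tau : twisting td_X td_G;
  td_act : left_action td_G td_F
}.

Record twisted_map (D D' : twisted_data) := TwistedMap {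
  tm_X : sset_map (td_X D) (td_X D');
  tm_G : td_G D -> td_G D';
  tm_F : td_F D -> td_F D';
  tm_GM : {morph tm_G : g h / (g * h)%g};
  tm_tau : forall n (x : td_X D n.+1),
    td_tau D' n (tm_X n.+1 x) = tm_G (td_tau D n x);
  tm_act : forall g y, tm_F (td_act D g y) = td_act D' (tm_G g) (tm_F y)
}.

Definition td_prod (D : twisted_data) : sset :=
  twisted_product (td_tau D) (td_act D).

Section ProdMap.
Variables (D D' : twisted_data) (f : twisted_map D D').

Definition tm_prod_fun n (z : td_prod D n) : td_prod D' n :=
  (tm_X f n z.1, tm_F f z.2).

Fact tm_prod_face n i (z : td_prod D n.+1) : (i <= n.+1)%N ->
  tm_prod_fun (face i z) = face i (tm_prod_fun z).
Proof.
case: z => x y hi; rewrite /tm_prod_fun /= /tw_face /= smap_face //.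
by case: i hi => //= _; rewrite tm_act tm_tau.
Qed.

Fact tm_prod_degen n i (z : td_prod D n) : (i <= n)%N ->
  tm_prod_fun (degen i z) = degen i (tm_prod_fun z).
Proof.
by case: z => x y hi; rewrite /tm_prod_fun /= /tw_degen /= smap_degen.
Qed.

Definition tm_prod : sset_map (td_prod D) (td_prod D') :=
  SSetMap tm_prod_face tm_prod_degen.

End ProdMap.

Record twisted_ss (D : twisted_data) := TwistedSS {
  tss :> spectral_sequence k;
  tss_first : first_page (td_X D) (td_act D) tss;
  tss_conv : convergence tss (td_prod D)
}.

(* The morphism of spectral sequences [phi] is the one induced by [f]: it is
   f^* (x) f^* on E_1 and agrees with f^* on the abutment. *)
Record induces (D D' : twisted_data) (f : twisted_map D D')
    (E : twisted_ss D) (E' : twisted_ss D') (phi : ss_map E' E) : Prop :=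
  Induces {
  induces_first : forall (a : int * int) n (e : a.1 + a.2 = n%:Z) x u,
    phi 1%N a (tens (tss_first E') e x u) =
      tens (tss_first E) e (hmap (tm_X f) x) (fgr_map (td_act D) (tm_F f) u);
  induces_fil : forall q n x, x \in fil (tss_conv E') q n ->
    hmap (tm_prod f) x \in fil (tss_conv E) q n;
  induces_edge : forall r (a : int * int) n (e : a.1 + a.2 = n%:Z) x,
    (stable (tss_conv E') a <= r)%N -> (stable (tss_conv E) a <= r)%N ->
    edge (tss_conv E) r e (phi r a x) =
      cls _ _ (hmap (tm_prod f) (rep (edge (tss_conv E') r e x)))
}.

End Main.

(* Main.v *)
From mathcomp Require Import all_boot all_order fingroup all_algebra.
From HB Require Import structures.
From mathcomp Require Import ring zify.
From mathcomp Require Import boolp classical_sets functions.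
Require Import Defs.
Set Implicit Arguments.
Unset Strict Implicit.
Unset Printing Implicit Defensive.
Import Order.TTheory GRing.Theory Num.Theory.
Local Open Scope ring_scope.

(* A normalized n-cochain of the twisted product is a normalized n-cochain of X
   with values in the functions on F. Filter it by the F^q. The coboundary differs
   from the untwisted one only by the term with face 0, where c(d_0 x) is replaced
   by its translate under tau(x), and the cup product from the componentwise one
   by a translation of the second factor. As (g - 1) c lies in F^(q+1) for c in
   F^q, both corrections raise the filtration degree, so the filtered dga of
   cochains has the spectral sequence with first page H(X; gr F) = H(X) (x) gr F.
   Nilpotence of the augmentation ideal makes the filtration finite. *)

(** The gain of one filtration step by [(g - 1) c] is a duality: pairing [g c - c] with [a^p k[F]]
    amounts to pairing [c] with [(g - 1) a^p k[F]], which lies in [a^(p+1) k[F]]. At the top, [F^0]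
    consists of the [G]-invariant functions, so the difference vanishes there, in accordance with
    [F^1 = 0].

    [X] may have infinitely many simplices in every dimension, so all finiteness comes from [F] and
    [G]. As [F] is finite, [gr^q(F)] has a finite basis, and a cochain with values in [F^q] is,
    modulo [F^(q+1)], a finite sum of products of a cochain on [X] with a basis function. This
    yields the universal property of the tensor product for arbitrary [H(X)]. If [a^P = 0], then
    [F^(-P)] is all of [C^0(F)]; the bounds [- P] and [1] of the filtration are the same in all
    degrees, and every bidegree has an explicit page from which on nothing changes. *)

Section SubmodClosed.
Variables (k : fieldType) (V : lmodType k) (Z : submodClosed V).

Lemma submodN u : u \in Z -> - u \in Z.
Proof. by rewrite -scaleN1r; apply: rpredZ. Qed.

Lemma submodB u v : u \in Z -> v \in Z -> u - v \in Z.
Proof. by move=> hu hv; rewrite rpredD ?submodN. Qed.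

End SubmodClosed.

(** * Linear maps out of subquotients *)

Section SubquoLift.
Variables (k : fieldType) (V T : lmodType k) (Z B : submodClosed V).

Definition linear_on (f : V -> T) : Prop :=
  forall a u v, u \in Z -> v \in Z -> f (a *: u + v) = a *: f u + f v.

Variables (f : V -> T) (fl : linear_on f).
Hypothesis fB : forall u, u \in Z -> u \in B -> f u = 0.

(** The two proofs are arguments so that unification can recover them when the linear structure is
    attached to the term below. *)
Definition subquo_lift of linear_on f & (forall u, u \in Z -> u \in B -> f u = 0)
  : subquo Z B -> T := fun x => f (rep x).

Lemma subquo_liftE u : u \in Z -> subquo_lift fl fB (cls Z B u) = f u.
Proof.
move=> Zu; rewrite /subquo_lift; have Zr := rep_in (cls Z B u).
have Zd : rep (cls Z B u) - u \in Z by rewrite submodB.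
rewrite -{1}[rep _](subrK u) -[X in f (X + _)]scale1r fl //.
by rewrite fB ?scaler0 ?add0r // cls_rep.
Qed.

Fact subquo_lift_linear : linear (subquo_lift fl fB).
Proof.
move=> a x y; rewrite -{1}[x]repK -{1}[y]repK -clsD ?rep_in //.
by rewrite subquo_liftE ?fl ?rpredD ?rpredZ ?rep_in.
Qed.

End SubquoLift.

HB.instance Definition _ (k : fieldType) (V T : lmodType k)
    (Z B : submodClosed V) (f : V -> T) (fl : linear_on Z f)
    (fB : forall u, u \in Z -> u \in B -> f u = 0) :=
  GRing.isLinear.Build k (subquo Z B) T *:%R (subquo_lift fl fB)
    (subquo_lift_linear fl fB).

Section Subquo.
Variables (k : fieldType) (V : lmodType k) (Z B : submodClosed V).

Lemma cls_eq0 v : v \in Z -> v \in B -> cls Z B v = 0.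
Proof.
move=> Zv Bv.
have -> : (0 : subquo Z B) = cls Z B 0.
  by have := @clsD k V Z B (-1) _ _ (rpred0 Z) (rpred0 Z);
     rewrite scaler0 addr0 scaleN1r addNr.
by apply/clsP; rewrite ?subr0 ?rpred0.
Qed.

Lemma cls0 : cls Z B 0 = 0.
Proof. by apply: cls_eq0; rewrite rpred0. Qed.

Lemma cls_eq0P v : v \in Z -> cls Z B v = 0 -> v \in B.
Proof.
move=> Zv; rewrite -cls0 => /(@clsP k V Z B v 0 Zv (rpred0 _)).
by rewrite subr0.
Qed.

Lemma subquo_ind (P : subquo Z B -> Prop) :
  (forall v, v \in Z -> P (cls Z B v)) -> forall x, P x.
Proof. by move=> h x; rewrite -[x]repK; apply: h; exact: rep_in. Qed.

Lemma clsDD u v : u \in Z -> v \in Z -> cls Z B (u + v) = cls Z B u + cls Z B v.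
Proof. by move=> Zu Zv; rewrite -{1}[u]scale1r clsD // scale1r. Qed.

Lemma clsZ a v : v \in Z -> cls Z B (a *: v) = a *: cls Z B v.
Proof. by move=> Zv; rewrite -[a *: v]addr0 clsD ?rpred0 // cls0 addr0. Qed.

Lemma cls_sum (I : Type) (s : seq I) (F : I -> V) :
  (forall i, F i \in Z) -> cls Z B (\sum_(i <- s) F i) = \sum_(i <- s) cls Z B (F i).
Proof.
move=> h; elim: s => [|i s IH]; first by rewrite !big_nil cls0.
by rewrite !big_cons clsDD ?IH ?rpred_sum // => j _.
Qed.

End Subquo.

(** * The spectral sequence of a filtered differential graded algebra *)

Section FilteredDGA.
Variable k : fieldType.

(** Degree and filtration are subspaces of one carrier, so equations between degrees require no
    transport. Associativity, the unit laws and the Leibniz rule are asked of homogeneous elements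
    only: the carrier of interest also contains elements with components in infinitely many degrees
    and non-normalized ones. *)
Record filtered_dga := FilteredDGA {
  carrier :> lmodType k;
  deg : int -> submodClosed carrier;
  flt : int -> submodClosed carrier;
  dif : {linear carrier -> carrier};
  prd : carrier -> carrier -> carrier;
  unt : carrier;
  flt_le : forall p q v, p <= q -> v \in flt q -> v \in flt p;
  dif_deg : forall n v, v \in deg n -> dif v \in deg (n + 1);
  dif_flt : forall q v, v \in flt q -> dif v \in flt q;
  dif_dif : forall v, dif (dif v) = 0;
  prd_bilinear : bilinear_map prd;
  prd_deg : forall m n u v, u \in deg m -> v \in deg n ->
    prd u v \in deg (m + n);
  prd_flt : forall p q u v, u \in flt p -> v \in flt q ->
    prd u v \in flt (p + q);
  prd_assoc : forall l m n u v w, u \in deg l -> v \in deg m -> w \in deg n ->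
    prd (prd u v) w = prd u (prd v w);
  unt_deg : unt \in deg 0;
  unt_flt : unt \in flt 0;
  unt_prd : forall n v, v \in deg n -> prd unt v = v;
  prd_unt : forall n v, v \in deg n -> prd v unt = v;
  dif_prd : forall n u v, u \in deg n ->
    dif (prd u v) = prd (dif u) v + (-1) ^+ absz n *: prd u (dif v)
}.

Variable A : filtered_dga.
Implicit Types (u v w x y z : A) (n q s : int) (a b c : int * int).
Local Notation d := (dif A).
Local Notation "u ** v" := (prd u v) (at level 40, left associativity).

(* With n = a.1 + a.2 and q = a.2, the page r at bidegree a is Z_r / B_r for
   Z_r = almost_cycles n q (q + r) and
   B_r = almost_cycles n (q + 1) (q + r)
         + d (almost_cycles (n - 1) (q - r + 1) q). *)
Definition almost_cycles n q s : {pred A} :=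
  fun v => [&& v \in deg A n, v \in flt A q & d v \in flt A s].

Lemma almost_cyclesP n q s v :
  reflect [/\ v \in deg A n, v \in flt A q & d v \in flt A s]
    (v \in almost_cycles n q s).
Proof. exact: and3P. Qed.

Fact almost_cycles_closed n q s : submod_closed (almost_cycles n q s).
Proof.
split=> [|a u v /almost_cyclesP[h1 h2 h3] /almost_cyclesP[h4 h5 h6]];
  apply/almost_cyclesP; split; rewrite ?linear0 ?rpred0 //.
- by rewrite rpredD ?rpredZ.
- by rewrite rpredD ?rpredZ.
- by rewrite linearP rpredD ?rpredZ.
Qed.
HB.instance Definition _ n q s :=
  GRing.isSubmodClosed.Build k A (almost_cycles n q s)
    (@almost_cycles_closed n q s).

Lemma almost_cyclesW n q s n' q' s' v : n = n' -> q' <= q -> s' <= s ->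
  v \in almost_cycles n q s -> v \in almost_cycles n' q' s'.
Proof.
move=> <- hq hs /almost_cyclesP[h1 h2 h3]; apply/almost_cyclesP.
by split=> //; [apply: flt_le h2 | apply: flt_le h3].
Qed.

Lemma dif_almost_cycles n q s t v : v \in almost_cycles n q s ->
  d v \in almost_cycles (n + 1) s t.
Proof.
case/almost_cyclesP=> h1 h2 h3; apply/almost_cyclesP.
by rewrite dif_deg // dif_dif rpred0.
Qed.

(** By the Leibniz rule [d (u ** v)] is a sum of terms in filtrations [s + q] and [p + t]. On page
    [r], where [s = p + r] and [t = q + r], both are [p + q + r]. *)
Lemma prd_almost_cycles m n p q s t u v :
  u \in almost_cycles m p s -> v \in almost_cycles n q t ->
  u ** v \in almost_cycles (m + n) (p + q) (Num.min (s + q) (p + t)).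
Proof.
case/almost_cyclesP=> h1 h2 h3 /almost_cyclesP[h4 h5 h6]; apply/almost_cyclesP.
split; [exact: prd_deg | exact: prd_flt | rewrite (dif_prd _ h1)].
apply: rpredD; last apply: rpredZ.
  by apply: flt_le (prd_flt h3 h5); rewrite ge_min lexx.
by apply: flt_le (prd_flt h2 h6); rewrite ge_min lexx orbT.
Qed.

(** The Leibniz rule for [1 = 1 ** 1] gives [d 1 = d 1 + d 1]; cancelling one summand works in every
    characteristic. *)
Lemma dif_unt : d (unt A) = 0.
Proof.
have := dif_prd (unt A) (unt_deg A); rewrite expr0 scale1r.
rewrite (unt_prd (unt_deg A)) (unt_prd (dif_deg (unt_deg A))).
by rewrite (prd_unt (dif_deg (unt_deg A))) -[LHS]addr0 => /addrI.
Qed.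

Definition page_cycles (r : nat) a : {pred A} :=
  almost_cycles (a.1 + a.2) a.2 (a.2 + r%:Z).
HB.instance Definition _ r a := GRing.SubmodClosed.on (page_cycles r a).

Definition page_boundaries (r : nat) a : {pred A} := fun v =>
  `[< exists x y, [/\ x \in almost_cycles (a.1 + a.2) (a.2 + 1) (a.2 + r%:Z),
      y \in almost_cycles (a.1 + a.2 - 1) (a.2 - r%:Z + 1) a.2 & v = x + d y] >].

Fact page_boundaries_closed r a : submod_closed (page_boundaries r a).
Proof.
split=> [|c _ _ /asboolP[x [y [hx hy ->]]] /asboolP[x' [y' [hx' hy' ->]]]];
  apply/asboolP.
  by exists 0, 0; rewrite !rpred0 linear0 addr0.
exists (c *: x + x'), (c *: y + y').
by rewrite !rpredD ?rpredZ // linearP scalerDr addrACA.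
Qed.
HB.instance Definition _ r a :=
  GRing.isSubmodClosed.Build k A (page_boundaries r a)
    (@page_boundaries_closed r a).

Definition page_comp r a : lmodType k :=
  subquo (page_cycles r a) (page_boundaries r a).
Local Notation pcls r a := (cls (page_cycles r a) (page_boundaries r a)).

Lemma page_boundaryl r a n q s v : v \in almost_cycles n q s ->
  n = a.1 + a.2 -> a.2 + 1 <= q -> a.2 + r%:Z <= s ->
  v \in page_boundaries r a.
Proof.
move=> hv hn hq hs; apply/asboolP; exists v, 0; rewrite linear0 addr0 rpred0.
by split=> //; apply: almost_cyclesW hv.
Qed.

Lemma page_boundaryr r a n q s v : v \in almost_cycles n q s ->
  n = a.1 + a.2 - 1 -> a.2 - r%:Z + 1 <= q -> a.2 <= s ->
  d v \in page_boundaries r a.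
Proof.
move=> hv hn hq hs; apply/asboolP; exists 0, v; rewrite add0r rpred0.
by split=> //; apply: almost_cyclesW hv.
Qed.

Section PageDiff.
Variables (r : nat) (a b : int * int) (e : b = a + ddeg r).

Lemma page_diff_cycles v : v \in page_cycles r a -> d v \in page_cycles r b.
Proof.
rewrite e => hv.
(* As [d (d v) = 0], the bound for it is free; [a.2 + r + r] is the one that [Z_r] demands at [b],
   where [b.2 = a.2 + r]. *)
by apply: almost_cyclesW (dif_almost_cycles (a.2 + r%:Z + r%:Z) hv) => /=; lia.
Qed.

(** Applying [d] to [x + d y] leaves [d x], with [x] in filtration [a.2 + 1 = b.2 - r + 1]: a
    summand of the second kind in [B_r] at [b]. *)
Lemma page_diff_boundaries v :
  v \in page_boundaries r a -> d v \in page_boundaries r b.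
Proof.
rewrite e => /asboolP[x [y [hx hy ->]]]; rewrite linearD dif_dif addr0.
by apply: (page_boundaryr hx) => /=; lia.
Qed.

Fact page_diff_lin :
  linear_on (page_cycles r a) (fun v => pcls r b (d v)).
Proof.
by move=> c u v hu hv; rewrite linearP clsD ?page_diff_cycles.
Qed.

Fact page_diff_zero v : v \in page_cycles r a -> v \in page_boundaries r a ->
  pcls r b (d v) = 0.
Proof.
by move=> hv hv'; rewrite cls_eq0 ?page_diff_cycles ?page_diff_boundaries.
Qed.

Definition page_diff : {linear page_comp r a -> page_comp r b} :=
  subquo_lift page_diff_lin page_diff_zero.

Lemma page_diffE v : v \in page_cycles r a ->
  page_diff (pcls r a v) = pcls r b (d v).
Proof. exact: subquo_liftE. Qed.

End PageDiff.

Section PageMul.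
Variable r : nat.

Definition page_mul a b c (e : a + b = c) (x : page_comp r a)
  (y : page_comp r b) : page_comp r c := pcls r c (rep x ** rep y).

Definition page_one : page_comp r 0 := pcls r 0 (unt A).

Lemma page_mul_cycles a b c (e : a + b = c) u v :
  u \in page_cycles r a -> v \in page_cycles r b -> u ** v \in page_cycles r c.
Proof.
rewrite -e => hu hv; apply: almost_cyclesW (prd_almost_cycles hu hv) => /=; lia.
Qed.

Lemma prdDl u v w : (u + v) ** w = u ** w + v ** w.
Proof.
by have := (prd_bilinear A).1 w 1 u v; rewrite !scale1r.
Qed.

Lemma prdDr u v w : u ** (v + w) = u ** v + u ** w.
Proof.
by have := (prd_bilinear A).2 u 1 v w; rewrite !scale1r.
Qed.

Lemma prd0l w : 0 ** w = 0.
Proof. by apply: (addIr (0 ** w)); rewrite -prdDl !add0r. Qed.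

Lemma prd0r w : w ** 0 = 0.
Proof. by apply: (addIr (w ** 0)); rewrite -prdDr !add0r. Qed.

(** For the summand [d y] of a boundary, [d y ** v] is [d (y ** v)] up to a multiple of [y ** d v].
    The former is a boundary of the second kind. In the latter, [d v] gains [r] filtration steps
    while [y] lacks only [r - 1], so it has filtration [c.2 + 1] and is of the first kind. *)
Lemma page_mul_boundaryl a b c (e : a + b = c) u v :
  u \in page_boundaries r a -> v \in page_cycles r b ->
  u ** v \in page_boundaries r c.
Proof.
rewrite -e => /asboolP[x [y [hx hy ->]]] hv; rewrite prdDl; apply: rpredD.
  by apply: (page_boundaryl (prd_almost_cycles hx hv)) => /=; lia.
have [hy' _ _] := almost_cyclesP _ _ _ _ hy.
have -> : d y ** v = d (y ** v) - (-1) ^+ absz (a.1 + a.2 - 1)%R *: (y ** d v).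
  by rewrite (dif_prd _ hy') addrK.
apply: submodB; last apply: rpredZ.
  by apply: (page_boundaryr (prd_almost_cycles hy hv)) => /=; lia.
have hdv := dif_almost_cycles (b.2 + r%:Z + r%:Z) hv.
by apply: (page_boundaryl (prd_almost_cycles hy hdv)) => /=; lia.
Qed.

Lemma page_mul_boundaryr a b c (e : a + b = c) u v :
  u \in page_cycles r a -> v \in page_boundaries r b ->
  u ** v \in page_boundaries r c.
Proof.
rewrite -e => hu /asboolP[x [y [hx hy ->]]]; rewrite prdDr; apply: rpredD.
  by apply: (page_boundaryl (prd_almost_cycles hu hx)) => /=; lia.
have [hu' _ _] := almost_cyclesP _ _ _ _ hu.
(* The sign is invertible; put on the left, it makes the term exactly the one in the Leibniz rule
   for [u ** y]. *)
suff : (-1) ^+ absz (a.1 + a.2)%R *: (u ** d y) \in page_boundaries r (a + b).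
  by rewrite rpredZeq signr_eq0.
have -> : (-1) ^+ absz (a.1 + a.2)%R *: (u ** d y) = d (u ** y) - d u ** y.
  by rewrite (dif_prd _ hu') addrAC subrr add0r.
apply: submodB.
  by apply: (page_boundaryr (prd_almost_cycles hu hy)) => /=; lia.
have hdu := dif_almost_cycles (a.2 + r%:Z + r%:Z) hu.
by apply: (page_boundaryl (prd_almost_cycles hdu hy)) => /=; lia.
Qed.

Lemma page_mulE a b c (e : a + b = c) u v :
  u \in page_cycles r a -> v \in page_cycles r b ->
  page_mul e (pcls r a u) (pcls r b v) = pcls r c (u ** v).
Proof.
move=> hu hv; have hd := cls_rep (page_boundaries r a) hu.
have hd' := cls_rep (page_boundaries r b) hv.
rewrite /page_mul; set u' := rep _ in hd *; set v' := rep _ in hd' *.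
have hu' : u' \in page_cycles r a := rep_in _.
have hv' : v' \in page_cycles r b := rep_in _.
apply/clsP; try by apply: (page_mul_cycles e).
have -> : u' ** v' - u ** v = (u' - u) ** v' + u ** (v' - v).
  have := prdDl (u' - u) u v'; have := prdDr u (v' - v) v.
  by rewrite !subrK => -> ->; rewrite addrA addrK.
by apply: rpredD; [exact: (page_mul_boundaryl e) | exact: (page_mul_boundaryr e)].
Qed.

Lemma unt_cycles : unt A \in page_cycles r 0.
Proof.
apply/almost_cyclesP; rewrite dif_unt rpred0.
by split=> //; [exact: unt_deg | exact: unt_flt].
Qed.

Fact page_diff_diff a b c (e : b = a + ddeg r) (e' : c = b + ddeg r)
  (x : page_comp r a) : page_diff e' (page_diff e x) = 0.
Proof.
move: x; apply: subquo_ind => v hv; have hdv := page_diff_cycles e hv.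
by rewrite page_diffE // page_diffE // dif_dif cls0.
Qed.

Fact page_mul_bilinear a b c (e : a + b = c) : bilinear_map (page_mul e).
Proof.
split=> [y t x x' | x t y y'].
  move: x x' y; apply: subquo_ind => u hu; apply: subquo_ind => u' hu'.
  apply: subquo_ind => v hv; rewrite -clsD // !page_mulE ?rpredD ?rpredZ //.
  by rewrite (prd_bilinear A).1 clsD // (page_mul_cycles e).
move: x y y'; apply: subquo_ind => u hu; apply: subquo_ind => v hv.
apply: subquo_ind => v' hv'; rewrite -clsD // !page_mulE ?rpredD ?rpredZ //.
by rewrite (prd_bilinear A).2 clsD // (page_mul_cycles e).
Qed.

Lemma page_cycles_deg a v : v \in page_cycles r a -> v \in deg A (a.1 + a.2).
Proof. by case/almost_cyclesP. Qed.

Fact page_mul_assoc a b c ab bc abc (e1 : a + b = ab) (e2 : b + c = bc)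
  (e3 : ab + c = abc) (e4 : a + bc = abc)
  (x : page_comp r a) (y : page_comp r b) (z : page_comp r c) :
  page_mul e3 (page_mul e1 x y) z = page_mul e4 x (page_mul e2 y z).
Proof.
move: x y z; apply: subquo_ind => u hu; apply: subquo_ind => v hv.
apply: subquo_ind => w hw.
have huv := page_mul_cycles e1 hu hv; have hvw := page_mul_cycles e2 hv hw.
rewrite (page_mulE e1) // (page_mulE e2) // (page_mulE e3) // (page_mulE e4) //.
by rewrite (prd_assoc (page_cycles_deg hu) (page_cycles_deg hv)
  (page_cycles_deg hw)).
Qed.

Fact page_mul_onel a (e : 0 + a = a) (x : page_comp r a) :
  page_mul e page_one x = x.
Proof.
move: x; apply: subquo_ind => v hv; rewrite page_mulE ?unt_cycles //.
by rewrite (unt_prd (page_cycles_deg hv)).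
Qed.

Fact page_mul_oner a (e : a + 0 = a) (x : page_comp r a) :
  page_mul e x page_one = x.
Proof.
move: x; apply: subquo_ind => v hv; rewrite page_mulE ?unt_cycles //.
by rewrite (prd_unt (page_cycles_deg hv)).
Qed.

Fact page_leibniz a b c a' b' c' (e : a + b = c) (ea : a' = a + ddeg r)
  (eb : b' = b + ddeg r) (ec : c' = c + ddeg r) (e1 : a' + b = c')
  (e2 : a + b' = c') (x : page_comp r a) (y : page_comp r b) :
  page_diff ec (page_mul e x y) = page_mul e1 (page_diff ea x) y
    + (-1) ^+ absz (a.1 + a.2) *: page_mul e2 x (page_diff eb y).
Proof.
move: x y; apply: subquo_ind => u hu; apply: subquo_ind => v hv.
have hdu := page_diff_cycles ea hu; have hdv := page_diff_cycles eb hv.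
have h1 := page_mul_cycles e1 hdu hv; have h2 := page_mul_cycles e2 hu hdv.
rewrite (page_mulE e) // !page_diffE //; last exact: page_mul_cycles hu hv.
rewrite (page_mulE e1) // (page_mulE e2) // -clsZ // -clsDD ?rpredZ //.
by rewrite (dif_prd _ (page_cycles_deg hu)).
Qed.

Definition page_dbga : dbga k r :=
  DBGA page_diff_diff page_mul_bilinear page_mul_assoc page_mul_onel
    page_mul_oner page_leibniz.

End PageMul.
End FilteredDGA.

Arguments almost_cycles {k} A n q s.
Arguments page_cycles {k} A r a.
Arguments page_boundaries {k} A r a.

(** * The homology of page [r] is page [r + 1] *)

Section Turn.
Variables (k : fieldType) (A : filtered_dga k) (r : nat) (a : int * int).
Local Notation d := (dif A).
Local Notation E := (@page_dbga _ A).
Local Notation pcls r a := (cls (page_cycles A r a) (page_boundaries A r a)).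
Local Notation hcls := (cls (cycles (E r) a) (boundaries (E r) a)).

Lemma page_cyclesS v : v \in page_cycles A r.+1 a -> v \in page_cycles A r a.
Proof. by apply: almost_cyclesW; lia. Qed.

Lemma dif_page_cycles v :
  v \in page_cycles A r (a - ddeg r) -> d v \in page_cycles A r a.
Proof. by apply: page_diff_cycles; rewrite subrK. Qed.

Lemma page_cyclesS_cycles v :
  v \in page_cycles A r.+1 a -> pcls r a v \in cycles (E r) a.
Proof.
move=> hv; apply/eqP; rewrite /= page_diffE ?page_cyclesS //.
have hdv := dif_almost_cycles (a.2 + r%:Z + r%:Z) hv.
apply: cls_eq0; first exact: page_diff_cycles (page_cyclesS hv).
by apply: (page_boundaryl hdv) => /=; lia.
Qed.

(** In an element [x + d y] of [B_(r+1)], the cochain [y] has filtration [a.2 - r] and so represents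
    a class at the source of [d_r], while [x] already vanishes on page [r]. *)
Lemma page_boundariesS_boundaries v :
  v \in page_cycles A r.+1 a ->
  v \in page_boundaries A r.+1 a -> pcls r a v \in boundaries (E r) a.
Proof.
move=> hv /asboolP[x [y [hx hy e]]].
have hy' : y \in page_cycles A r (a - ddeg r).
  by apply: almost_cyclesW hy => /=; lia.
apply/asboolP; exists (pcls r _ y); rewrite /= page_diffE //.
apply/clsP; [exact: page_cyclesS | exact: dif_page_cycles |].
by rewrite e addrK; apply: (page_boundaryl hx); lia.
Qed.

Lemma boundaries_page_boundariesS v : v \in page_cycles A r.+1 a ->
  pcls r a v \in boundaries (E r) a -> v \in page_boundaries A r.+1 a.
Proof.
move=> hv /asboolP[y0]; move: y0; apply: subquo_ind => y hy.
rewrite /= page_diffE // => /clsP.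
case/(_ (page_cyclesS hv) (dif_page_cycles hy))/asboolP=> x' [y' [hx' hy' e]].
have {}e : v = x' + d (y' + y) by rewrite linearD addrA -e subrK.
apply/asboolP; exists x', (y' + y); split=> //; last first.
  by apply: rpredD; [apply: almost_cyclesW hy' | apply: almost_cyclesW hy] => /=;
    lia.
case/almost_cyclesP: hx' => h1 h2 _; apply/almost_cyclesP; split=> //.
(* Page [r] only places [d x'] in filtration [a.2 + r]; the missing step comes from [v], which lies
   in [Z_(r+1)]. *)
have -> : d x' = d v by rewrite e linearD dif_dif addr0.
by case/almost_cyclesP: hv.
Qed.

(** If [d_r] kills the class of [v], then [d v = x + d y] with [x] in filtration [a.2 + r + 1] and
    [y] in filtration [a.2 + 1]. Subtracting [y], an element of [B_r], keeps the class and improves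
    the coboundary to [x]. *)
Lemma cycles_page_cyclesS (x : E r a) : x \in cycles (E r) a ->
  exists2 v, v \in page_cycles A r.+1 a & x = pcls r a v.
Proof.
move: x; apply: subquo_ind => v hv /eqP; rewrite /= page_diffE //.
move/(cls_eq0P (page_diff_cycles erefl hv))/asboolP=> [x [y [hx hy e]]].
have hy' : y \in page_boundaries A r a by apply: (page_boundaryl hy) => /=; lia.
have hy2 : y \in page_cycles A r a by apply: almost_cyclesW hy => /=; lia.
have hvy : v - y \in page_cycles A r a by rewrite submodB.
exists (v - y); last by apply/clsP; rewrite // opprB addrC subrK.
case/almost_cyclesP: hvy => h1 h2 _; apply/almost_cyclesP; split=> //.
rewrite linearB e addrK; case/almost_cyclesP: hx => _ h3 _.
by apply: flt_le h3 => /=; lia.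
Qed.

(* Z_(r+1) is contained in Z_r, but a cycle of page r lifts to Z_(r+1) only after
   correcting its representative by an element of B_r; hence the isomorphism is
   constructed from page r + 1 to the homology of page r, then inverted. *)
Fact page_unturn_lin :
  linear_on (page_cycles A r.+1 a) (fun v => hcls (pcls r a v)).
Proof.
move=> c u v hu hv; have hu' := page_cyclesS_cycles hu.
by rewrite clsD ?page_cyclesS // clsD ?page_cyclesS_cycles.
Qed.

Fact page_unturn_zero v : v \in page_cycles A r.+1 a ->
  v \in page_boundaries A r.+1 a -> hcls (pcls r a v) = 0.
Proof.
move=> hv hv'; rewrite cls_eq0 ?page_cyclesS_cycles //.
exact: page_boundariesS_boundaries.
Qed.

Definition page_unturn : {linear E r.+1 a -> homology (E r) a} :=
  subquo_lift page_unturn_lin page_unturn_zero.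

Lemma page_unturnE v : v \in page_cycles A r.+1 a ->
  page_unturn (pcls r.+1 a v) = hcls (pcls r a v).
Proof. exact: subquo_liftE. Qed.

Lemma page_unturn_inj : injective page_unturn.
Proof.
suff h x : page_unturn x = 0 -> x = 0.
  by move=> x y e; apply/eqP; rewrite -subr_eq0; apply/eqP/h;
     rewrite linearB /= e subrr.
move: x; apply: subquo_ind => v hv; rewrite page_unturnE // => h.
apply: cls_eq0 => //; apply: boundaries_page_boundariesS => //.
exact: cls_eq0P (page_cyclesS_cycles hv) h.
Qed.

Lemma page_unturn_surj x : exists y, page_unturn y = x.
Proof.
move: x; apply: subquo_ind => x /cycles_page_cyclesS[v hv ->].
by exists (pcls r.+1 a v); rewrite page_unturnE.
Qed.

Definition page_turn (x : homology (E r) a) : E r.+1 a :=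
  projT1 (cid (page_unturn_surj x)).

Lemma page_turnK : cancel page_turn page_unturn.
Proof. by move=> x; rewrite /page_turn; case: cid. Qed.

Lemma page_unturnK : cancel page_unturn page_turn.
Proof. by move=> x; apply: page_unturn_inj; rewrite page_turnK. Qed.

Fact page_turn_linear : linear page_turn.
Proof.
by move=> c x y; apply: page_unturn_inj; rewrite linearP !page_turnK.
Qed.

HB.instance Definition _ := GRing.isLinear.Build k (homology (E r) a) (E r.+1 a)
  *:%R page_turn page_turn_linear.

Lemma page_turnE v : v \in page_cycles A r.+1 a ->
  page_turn (hcls (pcls r a v)) = pcls r.+1 a v.
Proof. by move=> hv; rewrite -page_unturnE // page_unturnK. Qed.

Lemma page_turn_bij : bijective page_turn.
Proof. exact: Bijective page_turnK page_unturnK. Qed.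

End Turn.

Section SpectralSequence.
Variables (k : fieldType) (A : filtered_dga k).
Local Notation d := (dif A).
Local Notation E := (@page_dbga _ A).
Local Notation pcls r a := (cls (page_cycles A r a) (page_boundaries A r a)).

Lemma page_turn_mul r (a b c : int * int) (e : a + b = c) x y :
  x \in cycles (E r) a -> y \in cycles (E r) b ->
  page_turn (cls _ (boundaries (E r) c) (mul (E r) e x y)) =
    mul (E r.+1) e (page_turn (cls _ (boundaries (E r) a) x))
      (page_turn (cls _ (boundaries (E r) b) y)).
Proof.
move=> /cycles_page_cyclesS[u hu ->] /cycles_page_cyclesS[v hv ->].
have huv := page_mul_cycles e hu hv.
rewrite (page_turnE hu) (page_turnE hv).
rewrite [mul (E r.+1) e _ _](page_mulE e hu hv).
rewrite [mul (E r) e _ _](page_mulE e (page_cyclesS hu) (page_cyclesS hv)).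
exact: page_turnE.
Qed.

Lemma page_turn_one r :
  page_turn (cls (cycles (E r) 0) (boundaries (E r) 0) (one (E r)))
  = one (E r.+1).
Proof. by rewrite /= page_turnE // unt_cycles. Qed.

Definition fdga_ss : spectral_sequence k :=
  @SpectralSequence k E (fun r a => @page_turn k A r a)
    (fun r a _ => @page_turn_bij k A r a)
    (fun r a b c e x y _ => @page_turn_mul r a b c e x y)
    (fun r _ => page_turn_one r).

End SpectralSequence.

(** * Morphisms of filtered algebras and of their spectral sequences *)

Section Morphism.
Variables (k : fieldType) (A A' : filtered_dga k).

Record fdga_map := FDGAMap {
  fdga_fun :> {linear A -> A'};
  fdga_deg : forall n v, v \in deg A n -> fdga_fun v \in deg A' n;
  fdga_flt : forall q v, v \in flt A q -> fdga_fun v \in flt A' q;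
  fdga_dif : forall v, fdga_fun (dif A v) = dif A' (fdga_fun v);
  fdga_prd : forall u v, fdga_fun (prd u v) = prd (fdga_fun u) (fdga_fun v);
  fdga_unt : fdga_fun (unt A) = unt A'
}.

Variable h : fdga_map.
Local Notation pcls A r a := (cls (page_cycles A r a) (page_boundaries A r a)).

Lemma fdga_almost_cycles n q s v :
  v \in almost_cycles A n q s -> h v \in almost_cycles A' n q s.
Proof.
case/almost_cyclesP=> h1 h2 h3; apply/almost_cyclesP.
by rewrite -fdga_dif fdga_deg // !fdga_flt.
Qed.

Section Page.
Variables (r : nat) (a : int * int).

Lemma fdga_page_cycles v : v \in page_cycles A r a -> h v \in page_cycles A' r a.
Proof. exact: fdga_almost_cycles. Qed.

Fact fdga_page_lin :
  linear_on (page_cycles A r a) (fun v => pcls A' r a (h v)).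
Proof. by move=> c u v hu hv; rewrite linearP clsD ?fdga_page_cycles. Qed.

Fact fdga_page_zero v : v \in page_cycles A r a ->
  v \in page_boundaries A r a -> pcls A' r a (h v) = 0.
Proof.
move=> hv /asboolP[x [y [hx hy e]]]; rewrite cls_eq0 ?fdga_page_cycles //.
apply/asboolP; exists (h x), (h y); rewrite !fdga_almost_cycles //.
by rewrite e linearD fdga_dif.
Qed.

Definition fdga_page : {linear fdga_ss A r a -> fdga_ss A' r a} :=
  subquo_lift fdga_page_lin fdga_page_zero.

Lemma fdga_pageE v : v \in page_cycles A r a ->
  fdga_page (pcls A r a v) = pcls A' r a (h v).
Proof. exact: subquo_liftE. Qed.

End Page.

Fact fdga_page_diff r (a b : int * int) (e : b = a + ddeg r) x :
  fdga_page r b (diff (fdga_ss A r) e x) =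
  diff (fdga_ss A' r) e (fdga_page r a x).
Proof.
move: x; apply: subquo_ind => v hv; have hdv := page_diff_cycles e hv.
rewrite fdga_pageE //= !page_diffE ?fdga_page_cycles //.
by rewrite -fdga_dif; exact: fdga_pageE.
Qed.

Fact fdga_page_mul r (a b c : int * int) (e : a + b = c) x y :
  fdga_page r c (mul (fdga_ss A r) e x y) =
  mul (fdga_ss A' r) e (fdga_page r a x) (fdga_page r b y).
Proof.
move: x y; apply: subquo_ind => u hu; apply: subquo_ind => v hv.
rewrite (fdga_pageE hu) (fdga_pageE hv) [mul (fdga_ss A r) e _ _](page_mulE e hu hv).
rewrite [RHS](page_mulE e (fdga_page_cycles hu) (fdga_page_cycles hv)).
by rewrite -fdga_prd; apply: fdga_pageE; exact: page_mul_cycles hu hv.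
Qed.

Fact fdga_page_one r :
  fdga_page r 0 (one (fdga_ss A r)) = one (fdga_ss A' r).
Proof.
by rewrite /= /page_one -(fdga_unt h); apply: fdga_pageE; exact: unt_cycles.
Qed.

Fact fdga_page_turn r a x : x \in cycles (fdga_ss A r) a ->
  fdga_page r.+1 a (turn (fdga_ss A) r a (cls _ _ x)) =
  turn (fdga_ss A') r a (cls _ _ (fdga_page r a x)).
Proof.
case/cycles_page_cyclesS=> v hv ->; rewrite [turn]lock.
have hv' := page_cyclesS hv.
rewrite (fdga_pageE hv') -lock [X in fdga_page _ _ X](page_turnE hv).
rewrite [RHS](page_turnE (fdga_page_cycles hv)); exact: fdga_pageE.
Qed.

Definition fdga_ss_map : ss_map (fdga_ss A) (fdga_ss A') :=
  @SSMap k _ _ fdga_page (fun r a b e x _ => @fdga_page_diff r a b e x)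
    (fun r a b c e x y _ => @fdga_page_mul r a b c e x y)
    (fun r _ => fdga_page_one r) (fun r a x _ => @fdga_page_turn r a x).

End Morphism.

(** * Cochains of the twisted product *)

Section Simplices.
Variable Y : sset.

Definition simplices : Type := {n : nat & Y n}.
Implicit Type s : simplices.

Definition dim s : nat := projT1 s.

(** A vertex is its own last face, so that iterates are always defined and their dimension is given
    by truncated subtraction; likewise for [zero_face]. *)
Definition last_face s : simplices :=
  match s with
  | existT 0 _ => s
  | existT n.+1 y => existT _ n (face n.+1 y)
  end.

Definition zero_face s : simplices :=
  match s with
  | existT 0 _ => s
  | existT n.+1 y => existT _ n (face 0 y)
  end.

Lemma dim_last_face i s : dim (iter i last_face s) = (dim s - i)%N.
Proof. by elim: i s => [|i IH] [[|n] y]; rewrite ?subn0 // iterSr IH. Qed.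

Lemma dim_zero_face i s : dim (iter i zero_face s) = (dim s - i)%N.
Proof. by elim: i s => [|i IH] [[|n] y]; rewrite ?subn0 // iterSr IH. Qed.

Lemma zero_last_face i j s : (i + j <= dim s)%N ->
  iter i zero_face (iter j last_face s) = iter j last_face (iter i zero_face s).
Proof.
(* On an edge the two sides are its two different ends, hence the bound. *)
have h1 s' : (1 < dim s')%N ->
    zero_face (last_face s') = last_face (zero_face s').
  case: s' => [[|[|n]] y] //= _.
  by congr (existT _ n); rewrite face_face ?leqnn.
have h2 i' s' : (i' < dim s')%N ->
    iter i' zero_face (last_face s') = last_face (iter i' zero_face s').
  elim: i' s' => [//|i' IH] s' hi.
  have hd := dim_zero_face 1 s'; rewrite /= in hd.
  by rewrite !iterSr h1 ?IH ?hd //; lia.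
elim: j s => [//|j IH] s hj; have hd := dim_last_face 1 s; rewrite /= in hd.
by rewrite !iterSr IH ?hd ?h2 //; lia.
Qed.

Lemma existT_xcast m n (e : m = n) (y : Y m) :
  existT (fun n => Y n) n (xcast e y) = existT _ m y.
Proof. by case: _ / e. Qed.

Lemma iter_zero_face m n (y : Y (m + n)) :
  iter m zero_face (existT _ (m + n)%N y) = existT _ n (back y).
Proof. by elim: m y => [|m IH] y //; rewrite iterSr /= IH. Qed.

Lemma iter_last_face m n (y : Y (m + n)) :
  iter n last_face (existT _ (m + n)%N y) = existT _ m (front y).
Proof.
rewrite /front -(existT_xcast (addnC m n) y) -/(xcast _ _).
move: (xcast _ y) => {}y.
by elim: n y => [|n IH] y //; rewrite iterSr /= IH.
Qed.

End Simplices.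

(** * The differential graded algebra of cochains of a simplicial set *)

Section TotalCochains.
Variables (k : fieldType) (Y : sset).

(* Inhomogeneous cochains: working with functions on simplices of all dimensions
   avoids transports along equations between degrees. *)
Definition total : lmodType k := simplices Y -> k^o.
Implicit Types (u v w : total) (s : simplices Y).

Definition component n v : cochain k Y n := fun y => v (existT _ n y).
Arguments component : clear implicits.

(** Normalization is made part of homogeneity, so each statement about degrees carries it along.
    Degrees are integers because [p + q] may be negative on a page. *)
Definition total_deg (n : int) : {pred total} := fun v =>
  `[< (forall s, (dim s)%:Z != n -> v s = 0) /\
      (forall m, normalized (component m v)) >].

Lemma total_degP n v :
  reflect ((forall s, (dim s)%:Z != n -> v s = 0) /\
      (forall m, normalized (component m v))) (v \in total_deg n).
Proof. exact: asboolP. Qed.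

Fact total_deg_closed n : submod_closed (total_deg n).
Proof.
split=> [|a u v /total_degP[h1 h2] /total_degP[h3 h4]]; apply/total_degP.
  by split=> // m; exact: normalized0.
split=> [s hs | m].
  by rewrite -[LHS]/(a * u s + v s) h1 // h3 // mulr0 addr0.
exact: normalizedD.
Qed.
HB.instance Definition _ n :=
  GRing.isSubmodClosed.Build k total (total_deg n) (@total_deg_closed n).

Lemma total_deg_neg n v : v \in total_deg n -> n < 0 -> v = 0.
Proof. by case/total_degP=> h _ hn; apply/funext=> s; apply: h; lia. Qed.

Definition total_dif v : total := fun s =>
  match s with
  | existT 0 _ => 0
  | existT n.+1 y => cobound (component n v) y
  end.

Fact total_dif_linear : linear total_dif.
Proof.
move=> a u v; apply/funext=> -[[|n] y].
  by rewrite -[RHS]/(a * 0 + 0 : k) mulr0 addr0.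
exact: (congr1 (fun f => f y) (cobound_linear a (component n u) (component n v))).
Qed.
HB.instance Definition _ :=
  GRing.isLinear.Build k total total *:%R total_dif total_dif_linear.

(** The Alexander-Whitney product without reference to degrees: summing over all splittings into a
    front and a back face makes it bilinear on all functions. If [u] is homogeneous, only the
    splitting at its degree survives, see [total_prdE]. *)
Definition total_prd u v : total := fun s =>
  \sum_(i < (dim s).+1)
     u (iter (dim s - i) (@last_face Y) s) * v (iter i (@zero_face Y) s).

Definition total_unt : total := fun s => (dim s == 0%N)%:R.

Lemma total_prdE (m : nat) u v s : u \in total_deg m%:Z ->
  total_prd u v s =
    if (m <= dim s)%N
    then u (iter (dim s - m) (@last_face Y) s) * v (iter m (@zero_face Y) s)
    else 0.
Proof.
case/total_degP=> hu _; rewrite /total_prd.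
have u0 (i : 'I_(dim s).+1) : i != m :> nat ->
    u (iter (dim s - i) (@last_face Y) s) * v (iter i (@zero_face Y) s) = 0.
  move=> hi; rewrite hu ?mul0r // dim_last_face subKn //.
  by rewrite -ltnS ltn_ord.
case: leqP => hm.
  by rewrite (bigD1 (Ordinal (hm : m < (dim s).+1)%N)) //= big1 ?addr0.
by rewrite big1 // => i _; apply: u0; have := ltn_ord i; lia.
Qed.

Lemma total_prd_cup m n u v (y : Y (m + n)%N) : u \in total_deg m%:Z ->
  total_prd u v (existT _ (m + n)%N y) =
  cup (component m u) (component n v) y.
Proof.
move=> hu; rewrite (total_prdE _ _ hu) leq_addr addKn iter_last_face.
by rewrite iter_zero_face.
Qed.

Lemma total_prd_bilinear : bilinear_map total_prd.
Proof.
split=> [w a u v | w a u v]; apply/funext=> s;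
  rewrite -[RHS]/(a * total_prd _ _ s + total_prd _ _ s) /total_prd mulr_sumr;
  rewrite -big_split; apply: eq_bigr => i _ /=.
  rewrite -[(a *: u + v) _]/(a * u _ + v _); ring.
rewrite -[(a *: u + v) _]/(a * u _ + v _); ring.
Qed.

Lemma total_prd0l v : total_prd 0 v = 0.
Proof.
by apply/funext=> s; rewrite /total_prd big1 // => i _; rewrite mul0r.
Qed.

Lemma total_prd0r v : total_prd v 0 = 0.
Proof.
by apply/funext=> s; rewrite /total_prd big1 // => i _; rewrite mulr0.
Qed.

Lemma total_prd_deg m n u v : u \in total_deg m -> v \in total_deg n ->
  total_prd u v \in total_deg (m + n).
Proof.
case: m => [m|m] hu hv; last first.
  by rewrite (total_deg_neg hu) ?total_prd0l ?rpred0.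
case: n hv => [n|n] hv; last first.
  by rewrite (total_deg_neg hv) ?total_prd0r ?rpred0.
have hs s : (dim s)%:Z != m%:Z + n%:Z -> total_prd u v s = 0.
  move=> hs; rewrite (total_prdE _ _ hu); case: leqP => // hm.
  case/total_degP: hv => -> //; rewrite ?mulr0 // dim_zero_face; lia.
apply/total_degP; split=> // N.
have [->|hN] := eqVneq N (m + n)%N.
  have -> : component (m + n) (total_prd u v)
      = cup (component m u) (component n v).
    by apply/funext=> y; exact: total_prd_cup.
  by apply: cup_normalized; [case/total_degP: hu | case/total_degP: hv].
have -> : component N (total_prd u v) = 0; last exact: normalized0.
by apply/funext=> y; apply: hs => /=; lia.
Qed.

Lemma total_prd_assoc l m n u v w :
  u \in total_deg l -> v \in total_deg m -> w \in total_deg n ->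
  total_prd (total_prd u v) w = total_prd u (total_prd v w).
Proof.
case: l => [l|l] hu; last by rewrite (total_deg_neg hu) ?total_prd0l.
case: m => [m|m] hv; last first.
  by rewrite (total_deg_neg hv) ?total_prd0l ?total_prd0r ?total_prd0l.
move=> _; apply/funext=> s.
have huv : total_prd u v \in total_deg (l + m)%N%:Z.
  by rewrite PoszD; exact: total_prd_deg.
rewrite (total_prdE _ _ huv) (total_prdE _ _ hu) (total_prdE _ _ hu).
rewrite (total_prdE _ _ hv) dim_zero_face dim_last_face.
case: (leqP (l + m) (dim s)) => h; last first.
  by case: leqP => // h'; case: leqP => h2; rewrite ?mulr0 //; lia.
rewrite subKn // leq_addr (leq_trans (leq_addr m l) h).
rewrite [(m <= _ - _)%N](_ : _ = true); last by lia.
(* The face under the middle factor arises by dropping vertices at both ends; the two bracketings do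
   so in different orders. *)
rewrite addKn -zero_last_face; last by lia.
rewrite -!iterD -mulrA; congr (u (iter _ _ s) * (v (iter _ _ (iter _ _ s)) * _)).
- by lia.
- by lia.
by congr (w (iter _ _ s)); rewrite addnC.
Qed.

Lemma total_unt_deg : total_unt \in total_deg 0.
Proof.
apply/total_degP; split=> [s hs|[|m] //]; rewrite /total_unt.
by have -> : (dim s == 0%N) = false by lia.
Qed.

Lemma total_unt_prd n v : v \in total_deg n -> total_prd total_unt v = v.
Proof.
move=> _; apply/funext=> s; rewrite (total_prdE _ _ total_unt_deg) /=.
by rewrite /total_unt dim_last_face subn0 subnn mul1r.
Qed.

Lemma total_prd_unt n v : v \in total_deg n -> total_prd v total_unt = v.
Proof.
case: n => [n|n] hv; last by rewrite (total_deg_neg hv) ?total_prd0l.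
apply/funext=> s; rewrite (total_prdE _ _ hv) /total_unt dim_zero_face.
case: (ltngtP n (dim s)) => [h|h|<-]; last by rewrite subnn mulr1.
  rewrite (_ : (_ == _) = false) ?mulr0; last by lia.
  by case/total_degP: hv => -> //; lia.
by case/total_degP: hv => -> //; lia.
Qed.

Lemma total_dif_deg n v : v \in total_deg n -> total_dif v \in total_deg (n + 1).
Proof.
case/total_degP=> h1 h2; apply/total_degP; split=> [[[|m] y] //= hm | [|m] //].
  rewrite /cobound big1 // => i _; rewrite /component h1 ?mulr0 //=; lia.
exact: (cobound_normalized (h2 m)).
Qed.

Lemma total_dif_dif v : total_dif (total_dif v) = 0.
Proof.
apply/funext=> -[[|[|n]] y] //=.
  by rewrite /cobound big1 // => i _; rewrite mulr0.
exact: (congr1 (fun f => f y) (cobound_cobound (component n v))).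
Qed.

Lemma total_dif_prd n u v : u \in total_deg n ->
  total_dif (total_prd u v) =
  total_prd (total_dif u) v + (-1) ^+ absz n *: total_prd u (total_dif v).
Proof.
case: n => [m|m] hu; last first.
  by rewrite (total_deg_neg hu) ?total_prd0l // linear0 !total_prd0l scaler0 addr0.
have hdu := total_dif_deg hu; rewrite -PoszD addn1 in hdu.
apply/funext=> s.
rewrite -[RHS]/(total_prd (total_dif u) v s
  + (-1) ^+ m * total_prd u (total_dif v) s).
case: s => [[|N] y].
  rewrite (total_prdE _ _ hdu) (total_prdE _ _ hu) /= add0r.
  by case: leqP; rewrite ?mulr0 //; case: (m) => // _; rewrite mulr0 mulr0.
(* For [N < m] the terms vanish for reasons of degree, save one: if [m = N + 1], the back face in
   the last term is a vertex, where [total_dif v] is 0 by definition. For [m <= N] the cup product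
   rule applies with [n = N - m]. *)
case: (leqP m N) => hmN; last first.
  rewrite (total_prdE _ _ hdu) (total_prdE _ _ hu) /= ifF; last by lia.
  rewrite add0r /cobound big1 => [|i _]; last first.
    by rewrite /component (total_prdE _ _ hu) /= leqNgt hmN mulr0.
  case: leqP => h; last by rewrite mulr0.
  have : dim (iter m (@zero_face Y) (existT _ N.+1 y)) = 0%N.
    by rewrite dim_zero_face /=; lia.
  by case: (iter _ _ _) => -[|n'] z // _; rewrite !mulr0.
have [n eN] : exists n, N = (m + n)%N by exists (N - m)%N; rewrite subnKC.
move: y; rewrite {N hmN}eN => y /=.
have e : ((m + n).+1 = m + n.+1)%N by rewrite addnS.
rewrite (_ : component (m + n) (total_prd u v)
  = cup (component m u) (component n v)); last first.
  by apply/funext=> z; exact: total_prd_cup.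
rewrite (leibniz_cup _ _ e).
rewrite -[existT _ _ y in X in _ = _ + X](existT_xcast e) (total_prd_cup _ _ hu).
by rewrite -[X in _ = X + _]/(total_prd _ _ (existT _ (m.+1 + n)%N y))
   (total_prd_cup _ _ hdu).
Qed.

End TotalCochains.

(** * The filtration of the functions on [F] *)

Section FibreFiltration.
Variables (k : fieldType) (G : finGroupType) (F : finType).
Variable A : left_action G F.
Implicit Types (c : F -> k^o) (q : int).

Lemma ffilt_le p q c : p <= q -> c \in ffilt A q -> c \in ffilt A p.
Proof.
move=> hpq; have [n ->] : exists n : nat, q = p + n%:Z.
  by exists (absz (q - p)); lia.
elim: n => [|n IH]; first by rewrite addr0.
by rewrite -addn1 PoszD addrA => /ffilt_decr.
Qed.

Lemma ffilt_gt0 q c : 0 < q -> c \in ffilt A q -> c = 0.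
Proof. by move=> hq /ffiltP; rewrite leNgt hq. Qed.

(** This is the source of every gain in filtration below. For [q < 0] it is dual to [(g - 1) a^p]
    lying in [a^(p+1)]; for [q = 0] the function is invariant and the difference is 0. *)
Lemma ffilt_translateB q c g : c \in ffilt A q ->
  translate A c g - c \in ffilt A (q + 1).
Proof.
move=> hc; case: (ltP 0 q) => hq.
  rewrite (ffilt_gt0 hq hc) (_ : _ - _ = 0) ?rpred0 //.
  by apply/funext=> y; rewrite -[LHS]/(0 - 0 : k) subr0.
move/ffiltP: hc; rewrite hq => /kills_succP /(_ g) hc; apply/ffiltP.
case: (leP (q + 1) 0) => hq1.
  by have -> : (absz (q + 1)).+1 = absz q by lia.
have q0 : absz q = 0%N by lia.
by rewrite q0 in hc; exact: kills0 hc.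
Qed.

Lemma ffilt_translate q c g : c \in ffilt A q -> translate A c g \in ffilt A q.
Proof.
move=> hc; rewrite -[translate A c g](subrK c) rpredD //.
by apply: ffilt_le (ffilt_translateB g hc); lia.
Qed.

(** [F^(-P)] is the annihilator of [a^(P+1) k[F]], which is contained in [a^P k[F] = 0]. *)
Lemma ffilt_all P q c : (forall u : {ffun G -> k^o}, aug_pow P u -> u = 0) ->
  q <= - P%:Z -> c \in ffilt A q.
Proof.
move=> hP hq; apply: (ffilt_le hq); apply/ffiltP.
rewrite (_ : - P%:Z <= 0); last by lia.
have -> : absz (- P%:Z) = P by lia.
move=> m; apply: eval_span => _ [u [m' [/aug_powS/hP -> ->]]].
by rewrite gact0 eval0.
Qed.

(** Constants are [G]-invariant. This puts the unit cochain, whose fibres are constant, into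
    filtration 0. *)
Lemma ffilt_const a : (fun=> a) \in ffilt (k := k) A 0.
Proof.
apply/ffiltP; rewrite lexx; apply/kills_succP => g.
rewrite (_ : _ - _ = 0); first exact: kills_zero.
by apply/funext=> y; rewrite -[LHS]/(a - a) subrr.
Qed.

End FibreFiltration.

(** * The filtered cochain algebra of the twisted product *)

Section TwistedCochains.
Variables (k : fieldType) (X : sset) (G : finGroupType) (F : finType).
Variables (t : twisting X G) (A : left_action G F).
Local Notation Y := (twisted_product t A).
Local Notation C := (total k Y).
Implicit Types (u v w : C) (s : simplices X) (y : F) (q : int).

Definition lift_simplex s y : simplices Y :=
  existT (fun n => Y n) (projT1 s) (projT2 s, y).

Definition fibre v s : F -> k^o := fun y => v (lift_simplex s y).

Definition total_flt q : {pred C} := fun v =>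
  `[< forall s, fibre v s \in ffilt A q >].

Lemma total_fltP q v :
  reflect (forall s, fibre v s \in ffilt A q) (v \in total_flt q).
Proof. exact: asboolP. Qed.

Fact total_flt_closed q : submod_closed (total_flt q).
Proof.
split=> [|a u v /total_fltP hu /total_fltP hv]; apply/total_fltP => s.
  exact: (rpred0 (ffilt A q)).
exact: (rpredD (rpredZ a (hu s)) (hv s)).
Qed.
HB.instance Definition _ q :=
  GRing.isSubmodClosed.Build k C (total_flt q) (@total_flt_closed q).

Lemma total_flt_le p q v : p <= q -> v \in total_flt q -> v \in total_flt p.
Proof.
move=> h /total_fltP hv; apply/total_fltP => s; exact: ffilt_le (hv s).
Qed.

Lemma total_flt_gt0 q v : 0 < q -> v \in total_flt q -> v = 0.
Proof.
move=> hq /total_fltP hv; apply/funext=> -[n [x y]].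
by have := ffilt_gt0 hq (hv (existT _ n x)) => /(congr1 (fun f => f y)).
Qed.

Lemma total_flt_all P q v :
  (forall u : {ffun G -> k^o}, aug_pow P u -> u = 0) -> q <= - P%:Z ->
  v \in total_flt q.
Proof. by move=> hP hq; apply/total_fltP => s; exact: ffilt_all hP hq. Qed.

(** Only face 0 involves [tau]. Its term is split into the untwisted value, which completes the
    alternating sum over the faces in [X], and a difference [g c - c] to which [ffilt_translateB]
    applies. *)
Lemma fibre_dif v n (x : X n.+1) :
  fibre (total_dif v) (existT _ n.+1 x) =
  \sum_(i < n.+2) (-1) ^+ i *: fibre v (existT _ n (face i x))
  + (translate A (fibre v (existT _ n (face 0 x))) (t n x)
     - fibre v (existT _ n (face 0 x))).
Proof.
apply/funext=> y; rewrite big_ord_recl expr0 scale1r /=.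
rewrite addrAC addrCA subrr addr0.
rewrite /fibre /= /cobound big_ord_recl expr0 mul1r.
rewrite -[RHS]/(_ y + _ y); congr (_ + _).
rewrite fct_sumE; apply: eq_bigr => i _ //.
Qed.

Lemma total_dif_flt q v : v \in total_flt q -> total_dif v \in total_flt q.
Proof.
move/total_fltP=> hv; apply/total_fltP => -[[|n] x].
  exact: (rpred0 (ffilt A q)).
rewrite fibre_dif rpredD ?rpred_sum // => [i _|]; first by rewrite rpredZ.
by apply: ffilt_le (ffilt_translateB _ (hv _)); lia.
Qed.

(** The value 1 on vertices matches [zero_face], which fixes them. *)
Definition twist s : G :=
  match s with existT 0 _ => 1%g | existT n.+1 x => t n x end.

Lemma zero_face1 s y :
  zero_face (lift_simplex s y) = lift_simplex (zero_face s) (A (twist s) y).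
Proof. by case: s => -[|n] x //=; rewrite act1. Qed.

(** The product [tau(d_0^(i-1) s) ... tau(d_0 s) tau(s)], by which the [i]-fold face 0 moves the
    fibre coordinate. *)
Fixpoint back_twist i s : G :=
  if i is i'.+1 then (back_twist i' (zero_face s) * twist s)%g else 1%g.

Lemma zero_face_lift i s y : iter i (@zero_face Y) (lift_simplex s y) =
  lift_simplex (iter i (@zero_face X) s) (A (back_twist i s) y).
Proof.
by elim: i s y => [|i IH] s y; rewrite ?act1 // !iterSr actM -IH zero_face1.
Qed.

Lemma last_face_lift i s y : iter i (@last_face Y) (lift_simplex s y) =
  lift_simplex (iter i (@last_face X) s) y.
Proof.
elim: i s => [|i IH] s //; rewrite !iterSr -IH; congr (iter _ _ _).
by case: s => -[|n] x.
Qed.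

(** Front faces are iterated last faces and never use face 0; back faces iterate face 0. So the
    twist falls on the second factor alone. *)
Lemma fibre_prd u v s : fibre (total_prd u v) s =
  \sum_(i < (dim s).+1) fibre u (iter (dim s - i) (@last_face X) s)
    * translate A (fibre v (iter i (@zero_face X) s)) (back_twist i s).
Proof.
apply/funext=> y; rewrite fct_sumE; apply: eq_bigr => i _.
by rewrite last_face_lift zero_face_lift.
Qed.

Lemma total_prd_flt p q u v : u \in total_flt p -> v \in total_flt q ->
  total_prd u v \in total_flt (p + q).
Proof.
move=> /total_fltP hu /total_fltP hv; apply/total_fltP => s.
rewrite fibre_prd rpred_sum // => i _; apply: ffilt_mul; first exact: hu.
exact: ffilt_translate (hv _).
Qed.

Lemma total_unt_flt : @total_unt k Y \in total_flt 0.
Proof. by apply/total_fltP => s; exact: ffilt_const. Qed.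

Definition twisted_cochains : filtered_dga k :=
  @FilteredDGA k C (fun n => total_deg n) (fun q => total_flt q)
    (@total_dif k Y) (@total_prd k Y) (@total_unt k Y) total_flt_le
    (@total_dif_deg k Y) total_dif_flt (@total_dif_dif k Y)
    (@total_prd_bilinear k Y) (@total_prd_deg k Y) total_prd_flt
    (@total_prd_assoc k Y) (@total_unt_deg k Y) total_unt_flt
    (@total_unt_prd k Y) (@total_prd_unt k Y) (@total_dif_prd k Y).

End TwistedCochains.

Arguments total_flt {k X G F} t A q.

(** * Functoriality of the cochain algebra *)

Section Pullback.
Variables (k : fieldType) (Y Y' : sset) (f : sset_map Y Y').

Definition map_simplex (s : simplices Y) : simplices Y' :=
  existT _ (projT1 s) (f _ (projT2 s)).

Lemma map_last_face i s : map_simplex (iter i (@last_face Y) s) =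
  iter i (@last_face Y') (map_simplex s).
Proof.
elim: i s => [|i IH] s //; rewrite !iterSr IH; congr (iter _ _ _).
by case: s => -[|n] y //=; rewrite /map_simplex /= smap_face.
Qed.

Lemma map_zero_face i s : map_simplex (iter i (@zero_face Y) s) =
  iter i (@zero_face Y') (map_simplex s).
Proof.
elim: i s => [|i IH] s //; rewrite !iterSr IH; congr (iter _ _ _).
by case: s => -[|n] y //=; rewrite /map_simplex /= smap_face.
Qed.

Definition total_pull (v : total k Y') : total k Y := fun s => v (map_simplex s).

Fact total_pull_linear : linear total_pull.
Proof. by []. Qed.
HB.instance Definition _ := GRing.isLinear.Build k (total k Y') (total k Y)
  *:%R total_pull total_pull_linear.

Lemma total_pull_deg n v :
  v \in total_deg n -> total_pull v \in total_deg n.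
Proof.
case/total_degP=> h1 h2; apply/total_degP; split=> [s hs | m].
  exact: h1.
exact: (pull_normalized f (h2 m)).
Qed.

Lemma total_pull_dif v : total_pull (total_dif v) = total_dif (total_pull v).
Proof.
apply/funext=> -[[|n] y] //.
exact: (congr1 (fun g => g y) (pull_cobound f (component (n := n) v))).
Qed.

Lemma total_pull_prd u v :
  total_pull (total_prd u v) = total_prd (total_pull u) (total_pull v).
Proof.
apply/funext=> s; apply: eq_bigr => i _.
by rewrite /total_pull map_last_face map_zero_face.
Qed.

End Pullback.

Section TwistedPullback.
Variables (k : fieldType) (D D' : twisted_data) (f : twisted_map D D').
Local Notation C := (twisted_cochains k (td_tau D) (td_act D)).
Local Notation C' := (twisted_cochains k (td_tau D') (td_act D')).

Lemma total_pull_flt q (v : C') :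
  v \in flt C' q -> (total_pull (tm_prod f) v : C) \in flt C q.
Proof.
move=> /total_fltP hv; apply/total_fltP => s.
exact: (ffilt_map (A := td_act D) (tm_act f) (hv (map_simplex (tm_X f) s))).
Qed.

Definition twisted_pull : fdga_map C' C :=
  @FDGAMap k C' C (@total_pull k _ _ (tm_prod f)) (@total_pull_deg k _ _ (tm_prod f))
    total_pull_flt (@total_pull_dif k _ _ (tm_prod f))
    (@total_pull_prd k _ _ (tm_prod f)) erefl.

End TwistedPullback.

(** * The first page *)

Section Frames.
Variable k : fieldType.

(** A subspace of maximal dimension inside [Z] exhausts [Z]: adding the line through a further
    vector of [Z] would stay inside [Z]. *)
Lemma submod_vspace (V : vectType k) (Z : {pred V}) : submod_closed Z ->
  exists U : {vspace V}, forall v, (v \in U) = (v \in Z).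
Proof.
case=> Z0 ZD.
pose P d := `[< exists2 U : {vspace V}, {subset U <= Z} & \dim U = d >].
have P0 : exists d, P d.
  exists 0%N; apply/asboolP; exists 0%VS; last exact: dimv0.
  by move=> v; rewrite memv0 => /eqP->.
have Pmax d : P d -> (d <= \dim {:V})%N.
  by case/asboolP=> U _ <-; apply: dimvS; exact: subvf.
case: (ex_maxnP P0 Pmax) => d /asboolP[U hU dU] hmax; exists U => v.
apply/idP/idP=> [/hU //|hv].
have /hmax : P (\dim (U + <[v]>)).
  apply/asboolP; exists (U + <[v]>)%VS => // w /memv_addP[x hx [_ /vlineP[a ->] ->]].
  by rewrite addrC; apply: ZD; last exact: hU.
rewrite -dU => h; have eU : U == (U + <[v]>)%VS.
  by rewrite eqEdim addvSl.
by rewrite (eqP eU); apply: (subvP (addvSr U <[v]>)); exact: memv_line.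
Qed.

(* A basis of Z modulo B with its coordinate forms; the linear independence of u is
   never needed. *)
Lemma dual_frame (F : finType) (Z B : submodClosed (F -> k^o)) :
  exists d (u : 'I_d -> F -> k^o) (l : 'I_d -> (F -> k^o) -> k^o),
    [/\ forall i, u i \in Z, forall i, linear (l i),
      forall i c, c \in B -> l i c = 0 &
      forall c, c \in Z -> c - \sum_i (l i c : k) *: u i \in B].
Proof.
pose V : vectType k := {ffun F -> k^o}.
have closed (W : submodClosed (F -> k^o)) :
    submod_closed (fun w : V => (w : F -> k^o) \in W).
  split=> [|a u v hu hv].
    rewrite -topredE /= (_ : ((0 : V) : F -> k^o) = 0) ?rpred0 //.
    by apply/funext=> y; rewrite ffunE.
  rewrite -topredE /= (_ : ((a *: u + v : V) : F -> k^o) = a *: (u : F -> k^o) + v).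
    by apply: rpredD => //; apply: rpredZ.
  by apply/funext=> y; rewrite !ffunE.
have sub (W : submodClosed (F -> k^o)) :
    exists U : {vspace V}, forall v, (v \in U) = ((v : F -> k^o) \in W).
  exact: submod_vspace (closed W).
have [U hU] := sub Z; have [W hW] := sub B.
(* The projection of [U + W] along [W] onto the complement [U :\: W] of their intersection in [U].
   Its coordinates vanish on [B], and for [c] in [Z] the remainder [c - p c] lies in [B]. *)
pose p c : V := addv_pi1 U W (finfun c).
pose X := vbasis (U :\: W).
have finfunP a (c c' : F -> k^o) :
    finfun (a *: c + c') = a *: finfun c + finfun c' :> V.
  by apply/ffunP=> y; rewrite !ffunE.
have memP (M : {vspace V}) (S : submodClosed (F -> k^o)) :
    (forall v, (v \in M) = ((v : F -> k^o) \in S)) ->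
    forall c, (finfun c \in M) = (c \in S).
  by move=> h c; rewrite h; congr (_ \in S); apply/funext=> y; rewrite ffunE.
exists (\dim (U :\: W)), (fun i => X`_i : F -> k^o), (fun i c => coord X i (p c)).
split=> [i|i a c c'|i c hc|c hc].
- by rewrite -hU; apply: (subvP (diffvSl U W)); apply: vbasis_mem; apply: memt_nth.
- by rewrite /p finfunP !linearP.
- rewrite -(memP W B) // in hc.
  have := addv_pi1_pi2 (U := U) (subvP (addvSr U W) _ hc).
  rewrite addv_pi2_id // -[RHS]add0r => /addIr; rewrite /p => ->.
  by rewrite linear0.
rewrite -(memP U Z) // in hc.
have := addv_pi1_pi2 (subvP (addvSl U W) _ hc).
have := coord_vbasis (memv_pi (U :\: W) W (finfun c)).
rewrite -/(addv_pi1 U W) -/(p c) -/X => e e2.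
have -> : \sum_i (coord X i (p c) : k) *: (X`_i : F -> k^o) = p c.
  apply/funext=> y; rewrite fct_sumE [in RHS]e sum_ffunE.
  by apply: eq_bigr => i _; rewrite ffunE.
rewrite -(memP W B) // (_ : finfun _ = addv_pi2 U W (finfun c)) ?memv_pi2 //.
rewrite -[RHS](addKr (p c)) e2; apply/ffunP=> y; rewrite !ffunE.
exact: addrC.
Qed.

End Frames.

(** * Passage between homogeneous and inhomogeneous cochains *)

Section Embedding.
Variables (k : fieldType) (X : sset).

Definition embed n (c : cochain k X n) : total k X := fun s =>
  if projT1 s =P n is ReflectT e then c (xcast e (projT2 s)) else 0.

Lemma embedE n (c : cochain k X n) x : embed c (existT _ n x) = c x.
Proof. by rewrite /embed; case: eqP => //= e; rewrite xcast_id. Qed.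

Lemma embed_out n (c : cochain k X n) s : dim s <> n -> embed c s = 0.
Proof. by rewrite /embed; case: eqP. Qed.

Lemma embedP n (c : cochain k X n) (v : total k X) :
  (forall x, v (existT _ n x) = c x) -> (forall s, dim s <> n -> v s = 0) ->
  v = embed c.
Proof.
move=> h1 h2; apply/funext=> s; have [e|e] := eqVneq (dim s) n; last first.
  by rewrite h2 ?embed_out //; exact/eqP.
by case: s e => m x /= e; subst m; rewrite embedE h1.
Qed.

Lemma embed_component n (v : total k X) : v \in total_deg n%:Z ->
  embed (component (n := n) v) = v.
Proof.
case/total_degP=> h _; apply/esym/embedP => // s hs; apply: h.
by apply/eqP => -[].
Qed.

Lemma embed_deg n (c : cochain k X n) :
  normalized c -> embed c \in total_deg n%:Z.
Proof.
move=> hc; apply/total_degP; split=> [s hs | m].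
  by apply: embed_out => e; rewrite e eqxx in hs.
have [->|hm] := eqVneq m n.
  by rewrite (_ : component _ = c) //; apply/funext=> x; exact: embedE.
rewrite (_ : component _ = 0); first exact: normalized0.
by apply/funext=> x; apply: embed_out; exact/eqP.
Qed.

Lemma embed_linear n a (c c' : cochain k X n) :
  embed (a *: c + c') = a *: embed c + embed c'.
Proof.
apply/esym/embedP => [x|s hs].
  by rewrite -[LHS]/(a * embed c _ + embed c' _) !embedE.
by rewrite -[LHS]/(a * embed c _ + embed c' _) !embed_out // mulr0 addr0.
Qed.

Lemma embedB n (c c' : cochain k X n) : embed (c - c') = embed c - embed c'.
Proof.
by rewrite addrC -scaleN1r embed_linear scaleN1r addrC.
Qed.

Lemma embed0 n : embed (0 : cochain k X n) = 0.
Proof. by rewrite -[X in embed X](subrr 0) embedB subrr. Qed.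

Lemma embed_dif n (c : cochain k X n) :
  total_dif (embed c) = embed (cobound c).
Proof.
apply: embedP => [x|[[|m] x] //= hm].
  by apply: eq_bigr => i _; rewrite /component embedE.
rewrite /cobound big1 // => i _; rewrite /component embed_out ?mulr0 //=.
by move=> e; apply: hm; rewrite e.
Qed.

Lemma embed_cup m n (c : cochain k X m) (c' : cochain k X n) :
  normalized c -> normalized c' ->
  total_prd (embed c) (embed c') = embed (cup c c').
Proof.
move=> hc hc'; have hd := embed_deg hc.
apply: embedP => [x|s hs]; first by rewrite total_prd_cup // /cup /component !embedE.
have /total_degP[h _] := total_prd_deg hd (embed_deg hc').
by apply: h; apply/eqP => -[].
Qed.

Lemma embed_cocycle n c : c \in cocycles k X n ->
  embed c \in total_deg n%:Z /\ total_dif (embed c) = 0.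
Proof.
case/cocyclesP=> h1 h2; split; first exact: embed_deg.
by rewrite embed_dif h2 embed0.
Qed.

Lemma component_cocycle n (v : total k X) :
  v \in total_deg n%:Z -> total_dif v = 0 ->
  component (n := n) v \in cocycles k X n.
Proof.
case/total_degP=> _ h dv; apply/cocyclesP; split=> //; apply/funext=> x.
exact: (congr1 (fun f => f (existT _ n.+1 x)) dv).
Qed.

(** With integer degrees the case [n = 0] needs no separate form: the coboundary is 0 and [w = 0] in
    degree -1. *)
Lemma embed_coboundary n c : c \in coboundaries k X n ->
  exists2 w, w \in total_deg (n%:Z - 1) & embed c = total_dif w.
Proof.
case: n c => [|n] c; first by move/eqP->; exists 0; rewrite ?rpred0 ?linear0 ?embed0.
case/asboolP=> b hb ->; exists (embed b); last by rewrite embed_dif.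
have -> : n.+1%:Z - 1 = n%:Z by lia.
exact: embed_deg.
Qed.

Lemma component_coboundary n (w : total k X) : w \in total_deg (n%:Z - 1) ->
  component (n := n) (total_dif w) \in coboundaries k X n.
Proof.
case: n => [|n] hw.
  by rewrite (total_deg_neg hw) // linear0 rpred0.
apply/asboolP; exists (component (n := n) w) => //.
by case/total_degP: hw => _; apply.
Qed.

End Embedding.

(** * Cross products with functions on [F], and slices by linear forms *)

Section CrossProduct.
Variables (k : fieldType) (X : sset) (G : finGroupType) (F : finType).
Variables (t : twisting X G) (A : left_action G F).
Local Notation Y := (twisted_product t A).
Implicit Types (c : F -> k^o) (v : total k X) (w : total k Y).

(** The cochain-level cross product. The projection of the twisted product to [F] is in general not
    simplicial, so this respects differentials and products only up to the next filtration step. *)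
Definition cross v c : total k Y := fun s =>
  v (existT _ (projT1 s) (projT2 s).1) * c (projT2 s).2.

Lemma fibre_cross v c s : fibre (cross v c) s = v s *: c.
Proof. by case: s. Qed.

Lemma cross_flt q v c : c \in ffilt A q -> cross v c \in total_flt t A q.
Proof.
by move=> hc; apply/total_fltP => s; rewrite fibre_cross rpredZ.
Qed.

Lemma cross_deg n v c : v \in total_deg n -> cross v c \in total_deg n.
Proof.
case/total_degP=> h1 h2; apply/total_degP; split=> [[m [x y]] hm | [|m] // i].
  by rewrite /cross h1 ?mul0r.
move=> [x y] hi; rewrite /component /cross /=.
by rewrite [v _](h2 m.+1 i x hi) mul0r.
Qed.

(** The alternating sums over the faces in [X] cancel; what remains at [x] is [g c' - c'] for
    [c' = v(d_0 x) c] and [g = tau(x)]. *)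
Lemma cross_dif q v c : c \in ffilt A q ->
  total_dif (cross v c) - cross (total_dif v) c \in total_flt t A (q + 1).
Proof.
move=> hc; apply/total_fltP => -[n x].
rewrite (_ : fibre _ _ = fibre (total_dif (cross v c)) (existT _ n x)
  - fibre (cross (total_dif v) c) (existT _ n x)) // fibre_cross.
case: n x => [|n] x.
  by rewrite scale0r subr0; exact: (rpred0 (ffilt A (q + 1))).
rewrite fibre_dif addrAC [X in X + _](_ : _ = 0).
  by rewrite add0r; apply: ffilt_translateB; rewrite fibre_cross rpredZ.
apply/eqP; rewrite subr_eq0; apply/eqP.
rewrite [in RHS]/= /cobound scaler_suml; apply: eq_bigr => i _.
by rewrite fibre_cross scalerA.
Qed.

(** Each splitting contributes a multiple of [c (g c' - c')], in [F^p F^(q+1)]. There is no sign, as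
    functions on [F] have degree 0. *)
Lemma cross_prd p q u v c c' : c \in ffilt A p -> c' \in ffilt A q ->
  total_prd (cross u c) (cross v c') - cross (total_prd u v) (c * c')
    \in total_flt t A (p + q + 1).
Proof.
move=> hc hc'; apply/total_fltP => s.
rewrite (_ : fibre _ _ = fibre (total_prd (cross u c) (cross v c')) s
  - fibre (cross (total_prd u v) (c * c')) s) // fibre_cross fibre_prd.
rewrite /total_prd scaler_suml -sumrB rpred_sum // => i _; rewrite !fibre_cross.
set a := u _; set b := v _; set g := back_twist _ _ _.
rewrite (_ : _ - _ = (a * b) *: (c * (translate A c' g - c'))).
  by rewrite rpredZ // -addrA ffilt_mul // ffilt_translateB.
apply/funext=> y.
rewrite -[LHS]/((a * c y) * (b * c' (A g y)) - (a * b) * (c y * c' y)).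
rewrite -[RHS]/((a * b) * (c y * (c' (A g y) - c' y))); ring.
Qed.

Section Contraction.
Variable l : (F -> k^o) -> k^o.
Hypothesis l_linear : linear l.

Definition contract w : total k X := fun s => l (fibre w s).

HB.instance Definition _ := GRing.isLinear.Build k (F -> k^o) k^o *:%R l l_linear.

Lemma contract_linear a w w' :
  contract (a *: w + w') = a *: contract w + contract w'.
Proof. apply/funext=> s; exact: (linearP l). Qed.

Lemma contract_deg n w : w \in total_deg n -> contract w \in total_deg n.
Proof.
case/total_degP=> h1 h2; apply/total_degP; split=> [s hs | [|m] // i x hi].
  rewrite /contract (_ : fibre _ _ = 0) ?linear0 //.
  by apply/funext=> y; exact: h1.
rewrite /component /contract (_ : fibre _ _ = 0) ?linear0 //.
by apply/funext=> y; exact: (h2 m.+1 i (x, y) hi).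
Qed.

Lemma contract_zero q w : (forall c, c \in ffilt A q -> l c = 0) ->
  w \in total_flt t A q -> contract w = 0.
Proof. by move=> hl /total_fltP hw; apply/funext=> s; apply: hl. Qed.

(** A linear form that vanishes on [F^(q+1)] does not see the twist, so slicing with it is a chain
    map on filtration [q] to the cochains of [X]. *)
Lemma contract_dif q w : (forall c, c \in ffilt A (q + 1) -> l c = 0) ->
  w \in total_flt t A q -> contract (total_dif w) = total_dif (contract w).
Proof.
move=> hl /total_fltP hw; apply/funext=> -[[|n] x]; first exact: linear0.
rewrite /contract fibre_dif linearD /= [X in _ + X]hl ?ffilt_translateB // addr0.
by rewrite linear_sum; apply: eq_bigr => i _; rewrite linearZ.
Qed.

End Contraction.
End CrossProduct.

Arguments cross {k X G F} t A v c.
Arguments contract {k X G F} t A l w.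

(** * Page 1 as a tensor product *)

Section FirstPage.
Variables (k : fieldType) (X : sset) (G : finGroupType) (F : finType).
Variables (t : twisting X G) (A : left_action G F).
Local Notation C := (twisted_cochains k t A).
Local Notation pcls a := (cls (page_cycles C 1 a) (page_boundaries C 1 a)).
Local Notation fcls q := (cls (ffilt A q) (ffilt A (q + 1))).
Local Notation hcls n := (cls (cocycles k X n) (coboundaries k X n)).
Implicit Types a b : int * int.

(** For [r = 1] the conditions on coboundaries in [B_r] follow from [dif_flt], so [B_1] is
    [F^(q+1) + d F^q] in the given degree. This lemma and the next treat the two summands. *)
Lemma page1_boundaryl a v : v \in deg C (a.1 + a.2) ->
  v \in flt C (a.2 + 1) -> v \in page_boundaries C 1 a.
Proof.
move=> h1 h2; apply: (page_boundaryl (n := a.1 + a.2) (q := a.2 + 1)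
  (s := a.2 + 1)) => //.
by apply/almost_cyclesP; split=> //; exact: dif_flt.
Qed.

Lemma page1_boundaryr a v : v \in deg C (a.1 + a.2 - 1) ->
  v \in flt C a.2 -> dif C v \in page_boundaries C 1 a.
Proof.
move=> h1 h2; apply: (page_boundaryr (n := a.1 + a.2 - 1) (q := a.2)
  (s := a.2)) => //; last by lia.
by apply/almost_cyclesP; split=> //; exact: dif_flt.
Qed.

Section Degree.
Variables (a : int * int) (n : nat) (e : a.1 + a.2 = n%:Z).

Lemma cross_page_cycles z c : z \in cocycles k X n -> c \in ffilt A a.2 ->
  (cross t A (embed z) c : C) \in page_cycles C 1 a.
Proof.
case/embed_cocycle=> hz dz hc; apply/almost_cyclesP; split.
- by rewrite e; exact: cross_deg.
- exact: cross_flt.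
have := cross_dif t (embed z) hc; rewrite dz.
by rewrite (_ : cross t A 0 c = 0) ?subr0 //; apply/funext=> s; exact: mul0r.
Qed.

Definition page1_tens of a.1 + a.2 = n%:Z :=
  fun (x : cohomology k X n) (u : fgr k A a.2) =>
    (pcls a (cross t A (embed (rep x)) (rep u)) : fdga_ss C 1%N a).

Lemma page1_tensE z c : z \in cocycles k X n -> c \in ffilt A a.2 ->
  page1_tens e (hcls n z) (fcls a.2 c) = pcls a (cross t A (embed z) c).
Proof.
move=> hz hc; have hd := cls_rep (coboundaries k X n) hz.
have hd' := cls_rep (ffilt A (a.2 + 1)) hc; rewrite /page1_tens.
set z' := rep _ in hd *; set c' := rep _ in hd' *.
have hz' : z' \in cocycles k X n := rep_in _.
have hc' : c' \in ffilt A a.2 := rep_in _.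
apply/clsP; try exact: cross_page_cycles.
have -> : cross t A (embed z') c' - cross t A (embed z) c =
    cross t A (embed (z' - z)) c' + cross t A (embed z) (c' - c).
  apply/funext=> s; rewrite embedB.
  rewrite -[LHS]/(embed z' _ * c' _ - embed z _ * c _).
  rewrite -[RHS]/((embed z' _ - embed z _) * c' _ + embed z _ * (c' _ - c _)).
  ring.
have [hez _] := embed_cocycle hz.
apply: rpredD; last first.
  by apply: page1_boundaryl; [rewrite e; exact: cross_deg | exact: cross_flt].
have [w hw ->] := embed_coboundary hd.
(* With [z' - z] equal to the coboundary of [w]: its cross product with [c'] is the coboundary of
   [cross t A w c'] minus the twist correction, and both lie in [B_1]. *)
have -> : cross t A (total_dif w) c' = total_dif (cross t A w c')
    - (total_dif (cross t A w c') - cross t A (total_dif w) c').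
  by rewrite subKr.
apply: submodB.
  by apply: page1_boundaryr; [rewrite e; exact: cross_deg | exact: cross_flt].
have hdw : total_dif w \in total_deg n%:Z.
  by have := total_dif_deg hw; rewrite subrK.
apply: page1_boundaryl; last exact: cross_dif.
rewrite e; apply: submodB; last exact: cross_deg.
have := total_dif_deg (cross_deg t A c' hw); by rewrite subrK.
Qed.

Lemma page1_tens_bilinear : bilinear_map (page1_tens e).
Proof.
split=> [u r x x' | x r u u'].
  move: x x' u; apply: subquo_ind => z hz; apply: subquo_ind => z' hz'.
  apply: subquo_ind => c hc; rewrite -clsD // !page1_tensE ?rpredD ?rpredZ //.
  rewrite embed_linear -clsD ?cross_page_cycles //; congr (pcls a _).
  apply/funext=> s; rewrite -[LHS]/((r * embed z _ + embed z' _) * c _).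
  rewrite -[RHS]/(r * (embed z _ * c _) + embed z' _ * c _); ring.
move: x u u'; apply: subquo_ind => z hz; apply: subquo_ind => c hc.
apply: subquo_ind => c' hc'; rewrite -clsD // !page1_tensE ?rpredD ?rpredZ //.
rewrite -clsD ?cross_page_cycles //; congr (pcls a _).
apply/funext=> s; rewrite -[LHS]/(embed z _ * (r * c _ + c' _)).
rewrite -[RHS]/(r * (embed z _ * c _) + embed z _ * c' _); ring.
Qed.

Section Universal.
Variables (N : nat) (u : 'I_N -> F -> k^o) (l : 'I_N -> (F -> k^o) -> k^o).
Hypothesis u_in : forall i, u i \in ffilt A a.2.
Hypothesis l_linear : forall i, linear (l i).
Hypothesis l_zero : forall i c, c \in ffilt A (a.2 + 1) -> l i c = 0.
Hypothesis frame : forall c, c \in ffilt A a.2 ->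
  c - \sum_i (l i c : k) *: u i \in ffilt A (a.2 + 1).

Definition coordinate (i : 'I_N) (v : C) : cochain k X n :=
  component (n := n) (contract t A (l i) v).

Lemma coordinate_linear i r v v' :
  coordinate i (r *: v + v') = r *: coordinate i v + coordinate i v'.
Proof. by rewrite /coordinate contract_linear. Qed.

Lemma coordinate_cocycle i v :
  v \in page_cycles C 1 a -> coordinate i v \in cocycles k X n.
Proof.
case/almost_cyclesP; rewrite e => h1 h2 h3.
apply: component_cocycle; first exact: contract_deg.
rewrite -(contract_dif (l_linear i) (@l_zero i) h2).
exact: contract_zero (@l_zero i) h3.
Qed.

Lemma coordinate_coboundary i v :
  v \in page_boundaries C 1 a -> coordinate i v \in coboundaries k X n.
Proof.
case/asboolP=> x [y [/almost_cyclesP[_ hx _] /almost_cyclesP[h1 h2 _] ->]].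
rewrite /coordinate -[x]scale1r contract_linear //.
rewrite (contract_zero (@l_zero i) hx) scaler0 add0r.
have {}h2 : y \in total_flt t A a.2 by apply: flt_le h2; lia.
rewrite (contract_dif (l_linear i) (@l_zero i) h2).
by apply: component_coboundary; apply: contract_deg => //; rewrite -e.
Qed.

(** The frame is applied in every fibre: [fibre v s] agrees modulo [F^(q+1)] with the combination of
    the [u i] whose coefficients are the slices of [v] at [s]. The sum is finite since the frame is,
    whatever [X] may be. *)
Lemma page1_decomposition v : v \in page_cycles C 1 a ->
  pcls a v = \sum_i page1_tens e (hcls n (coordinate i v)) (fcls a.2 (u i)).
Proof.
move=> hv; have hcv i := coordinate_cocycle i hv.
under eq_bigr => i _ do rewrite page1_tensE //.
rewrite -(@cls_sum _ _ _ _ _ _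
  (fun i => cross t A (embed (coordinate i v)) (u i) : C)) => [|i]; last exact: cross_page_cycles.
have hs : \sum_i (cross t A (embed (coordinate i v)) (u i) : C)
    \in page_cycles C 1 a.
  by rewrite rpred_sum // => i _; exact: cross_page_cycles.
apply/clsP => //; apply: page1_boundaryl.
  by apply: submodB; [case/almost_cyclesP: hv | case/almost_cyclesP: hs].
case/almost_cyclesP: hv; rewrite e => h1 /total_fltP h2 _.
apply/total_fltP => s.
rewrite (_ : fibre _ _ = fibre v s - \sum_i (l i (fibre v s) : k) *: u i);
  first exact: frame.
apply/funext=> y.
rewrite -[LHS]/(fibre v s y - _ (lift_simplex t A s y)) fct_sumE.
rewrite -[RHS]/(fibre v s y - (\sum_i (l i (fibre v s) : k) *: u i) y) fct_sumE.
congr (_ - _); apply: eq_bigr => i _.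
rewrite /coordinate embed_component; last exact: contract_deg.
by rewrite /cross /contract; case: s.
Qed.

Variables (T : lmodType k) (g : cohomology k X n -> fgr k A a.2 -> T).
Hypothesis g_bilinear : bilinear_map g.

(** By [page1_decomposition] this is the only possible value of a linear map extending [g]. *)
Definition page1_lift_fun (v : C) : T :=
  \sum_i g (hcls n (coordinate i v)) (fcls a.2 (u i)).

Fact page1_lift_lin : linear_on (page_cycles C 1 a) page1_lift_fun.
Proof.
move=> r v v' hv hv'; rewrite /page1_lift_fun scaler_sumr -big_split.
apply: eq_bigr => i _ /=; rewrite coordinate_linear clsD ?coordinate_cocycle //.
exact: g_bilinear.1.
Qed.

Fact page1_lift_zero v : v \in page_cycles C 1 a ->
  v \in page_boundaries C 1 a -> page1_lift_fun v = 0.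
Proof.
move=> hv hv'; rewrite /page1_lift_fun big1 // => i _.
rewrite cls_eq0 ?coordinate_cocycle ?coordinate_coboundary //.
have := g_bilinear.1 (fcls a.2 (u i)) (-1) 0 0.
by rewrite scaler0 addr0 scaleN1r addNr.
Qed.

Definition page1_lift : {linear fdga_ss C 1%N a -> T} :=
  subquo_lift page1_lift_lin page1_lift_zero.

(** The slices of [z] crossed with [c] are [l i c] times [z]; bilinearity moves these scalars to the
    other argument, where they reassemble the class of [c]. *)
Lemma page1_liftE x c : page1_lift (page1_tens e x c) = g x c.
Proof.
move: x c; apply: subquo_ind => z hz; apply: subquo_ind => c hc.
rewrite page1_tensE // [LHS]subquo_liftE ?cross_page_cycles //.
have -> : fcls a.2 c = \sum_i (l i c : k) *: (fcls a.2 (u i) : fgr k A a.2).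
  have -> : fcls a.2 c = fcls a.2 (\sum_i (l i c : k) *: u i).
    apply/clsP => //; last exact: frame.
    by rewrite rpred_sum // => i _; rewrite rpredZ.
  rewrite cls_sum => [|i]; last exact: rpredZ.
  by apply: eq_bigr => i _; rewrite clsZ.
have gZ x (v : 'I_N -> fgr k A a.2) (r : 'I_N -> k) :
    g x (\sum_i r i *: v i) = \sum_i r i *: g x (v i).
  have h : linear (g x) := g_bilinear.2 x.
  elim/big_rec2: _ => [|i y1 y2 _ <-]; last exact: h.
  by have := h (-1) 0 0; rewrite scaler0 addr0 scaleN1r addNr.
rewrite gZ; apply: eq_bigr => i _.
have -> : coordinate i (cross t A (embed z) c) = (l i c : k) *: z.
  apply/funext=> x; rewrite /coordinate /component /contract fibre_cross embedE.
  have h := l_linear i; have l0 : l i 0 = 0.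
    by have := h (-1) 0 0; rewrite scaler0 addr0 scaleN1r addNr.
  rewrite -[z x *: c]addr0 h l0 addr0; exact: mulrC.
rewrite clsZ // -[l i c *: _]addr0 g_bilinear.1.
have -> : g 0 (fcls a.2 (u i)) = 0; last by rewrite addr0.
by have := g_bilinear.1 (fcls a.2 (u i)) (-1) 0 0;
  rewrite scaler0 addr0 scaleN1r addNr.
Qed.

End Universal.

Lemma page1_tens_tensor : is_tensor_product (page1_tens e).
Proof.
split=> [|T g hg]; first exact: page1_tens_bilinear.
have [N [u [l [hu hl h0 hf]]]] :=
  dual_frame (ffilt (k := k) A a.2) (ffilt A (a.2 + 1)).
exists (page1_lift u hl h0 hg); split=> [x c|h' hh']; first exact: page1_liftE.
apply: subquo_ind => v hv; rewrite (page1_decomposition hu hl h0 hf hv) !linear_sum.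
by apply: eq_bigr => i _; rewrite hh' page1_liftE.
Qed.

End Degree.

Lemma page1_neg a (x : fdga_ss C 1%N a) : a.1 + a.2 < 0 -> x = 0.
Proof.
move: x; apply: subquo_ind => v /almost_cyclesP[hv _ _] ha.
by rewrite (total_deg_neg hv ha) cls0.
Qed.

Lemma page1_tens_mul a b m n (ea : a.1 + a.2 = m%:Z) (eb : b.1 + b.2 = n%:Z)
    (eab : (a + b).1 + (a + b).2 = (m + n)%:Z)
    (x : cohomology k X m) (y : cohomology k X n) u v :
  mul (fdga_ss C 1%N) (erefl (a + b)) (page1_tens ea x u) (page1_tens eb y v) =
  page1_tens eab (hcup x y) (fgr_mul u v).
Proof.
move: x y u v; apply: subquo_ind => z hz; apply: subquo_ind => z' hz'.
apply: subquo_ind => c hc; apply: subquo_ind => c' hc'.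
rewrite hcupE // [fgr_mul _ _]fgr_mulE // !page1_tensE ?cup_cocycles //; last first.
  exact: ffilt_mul.
have h1 := cross_page_cycles ea hz hc; have h2 := cross_page_cycles eb hz' hc'.
rewrite [LHS](page_mulE (erefl (a + b)) h1 h2).
have h3 := page_mul_cycles (erefl (a + b)) h1 h2.
have h4 := cross_page_cycles eab (cup_cocycles hz hz') (ffilt_mul hc hc').
apply/clsP => //; apply: page1_boundaryl.
  by apply: submodB; [case/almost_cyclesP: h3 | case/almost_cyclesP: h4].
have [nz _] := cocyclesP _ hz; have [nz' _] := cocyclesP _ hz'.
by rewrite -embed_cup //; exact: cross_prd.
Qed.

Definition twisted_first_page : first_page X A (fdga_ss C) :=
  @Defs.FirstPage k X G F A (fdga_ss C) (fun a n e => page1_tens e)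
    (fun a n e => page1_tens_tensor e) page1_neg page1_tens_mul.

End FirstPage.

(** * Convergence and naturality *)

Section CohomologyMaps.
Variable k : fieldType.

Lemma hcup_bilinear (Y : sset) m n : bilinear_map (@hcup k Y m n).
Proof.
split=> [y r x x' | x r y y'].
  move: x x' y; apply: subquo_ind => u hu; apply: subquo_ind => u' hu'.
  apply: subquo_ind => v hv; rewrite -clsD // !hcupE ?rpredD ?rpredZ //.
  rewrite -clsD ?cup_cocycles //; congr (cls _ _ _); apply/funext=> s.
  rewrite -[LHS]/((r * u _ + u' _) * v _) -[RHS]/(r * (u _ * v _) + u' _ * v _).
  ring.
move: x y y'; apply: subquo_ind => u hu; apply: subquo_ind => v hv.
apply: subquo_ind => v' hv'; rewrite -clsD // !hcupE ?rpredD ?rpredZ //.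
rewrite -clsD ?cup_cocycles //; congr (cls _ _ _); apply/funext=> s.
rewrite -[LHS]/(u _ * (r * v _ + v' _)) -[RHS]/(r * (u _ * v _) + u _ * v' _).
ring.
Qed.

Lemma hmap_linear (X Y : sset) (f : sset_map X Y) n :
  linear (@hmap k X Y f n).
Proof.
move=> r x x'; move: x x'; apply: subquo_ind => u hu; apply: subquo_ind => u' hu'.
by rewrite -clsD // !hmapE ?rpredD ?rpredZ // -clsD ?pull_cocycles.
Qed.

End CohomologyMaps.

(** * The filtration of the abutment and the edge maps *)

Section Convergence.
Variables (k : fieldType) (X : sset) (G : finGroupType) (F : finType).
Variables (t : twisting X G) (A : left_action G F).
Local Notation Y := (twisted_product t A).
Local Notation C := (twisted_cochains k t A).
Local Notation E := (fdga_ss C).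
Local Notation pcls r a := (cls (page_cycles C r a) (page_boundaries C r a)).
Local Notation hcls n := (cls (cocycles k Y n) (coboundaries k Y n)).
Implicit Types (v w : C) (a b : int * int) (q : int).

Definition cocycle_flt q n : {pred C} :=
  fun v => [&& v \in deg C n%:Z, v \in flt C q & dif C v == 0].

Lemma cocycle_fltP q n v :
  reflect [/\ v \in deg C n%:Z, v \in flt C q & dif C v = 0]
    (v \in cocycle_flt q n).
Proof. by apply: (iffP and3P) => -[h1 h2 /eqP h3]; split. Qed.

Definition tcls n v : cohomology k Y n := hcls n (component (n := n) v).

Lemma cocycle_flt_component q n v :
  v \in cocycle_flt q n -> component (n := n) v \in cocycles k Y n.
Proof. case/cocycle_fltP=> h1 _ h2; exact: component_cocycle. Qed.

Lemma tclsD q n r u v : u \in cocycle_flt q n -> v \in cocycle_flt q n ->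
  tcls n (r *: u + v) = r *: tcls n u + tcls n v.
Proof.
move=> hu hv.
by rewrite /tcls -clsD ?(cocycle_flt_component hu) ?(cocycle_flt_component hv).
Qed.

Fact cocycle_flt_closed q n : submod_closed (cocycle_flt q n).
Proof.
split=> [|r u v /cocycle_fltP[h1 h2 h3] /cocycle_fltP[h4 h5 h6]].
  by apply/cocycle_fltP; rewrite !rpred0 linear0.
apply/cocycle_fltP; rewrite !rpredD ?rpredZ //; split=> //.
by rewrite linearP h3 h6 scaler0 addr0.
Qed.
HB.instance Definition _ q n :=
  GRing.isSubmodClosed.Build k C (cocycle_flt q n) (@cocycle_flt_closed q n).

Lemma cocycle_flt_le p q n v :
  p <= q -> v \in cocycle_flt q n -> v \in cocycle_flt p n.
Proof.
move=> h /cocycle_fltP[h1 h2 h3]; apply/cocycle_fltP; split=> //.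
exact: flt_le h2.
Qed.

(** Translates an equality of cohomology classes into an equation in the filtered algebra. It gives
    no filtration bound for [y]. *)
Lemma tcls_eq p q n v w : v \in cocycle_flt p n -> w \in cocycle_flt q n ->
  tcls n v = tcls n w -> exists2 y, y \in deg C (n%:Z - 1) & v = w + dif C y.
Proof.
move=> hv hw /(clsP _ (cocycle_flt_component hv) (cocycle_flt_component hw)).
move=> /embed_coboundary[y hy]; rewrite embedB !embed_component; last 2 first.
- by case/cocycle_fltP: hw.
- by case/cocycle_fltP: hv.
by move=> e; exists y => //; rewrite -[dif C y]e addrC subrK.
Qed.

Definition hfil q n : {pred cohomology k Y n} :=
  fun x => `[< exists2 v, v \in cocycle_flt q n & x = tcls n v >].

Arguments hfil : clear implicits.

Fact hfil_closed q n : submod_closed (hfil q n).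
Proof.
split=> [|r _ _ /asboolP[u hu ->] /asboolP[v hv ->]]; apply/asboolP.
  by exists 0; [exact: rpred0 | rewrite /tcls cls0].
by exists (r *: u + v); [rewrite rpredD ?rpredZ | rewrite (tclsD _ hu hv)].
Qed.
HB.instance Definition _ q n :=
  GRing.isSubmodClosed.Build k (cohomology k Y n) (hfil q n) (@hfil_closed q n).

Lemma tcls_hfil q n v : v \in cocycle_flt q n -> tcls n v \in hfil q n.
Proof. by move=> hv; apply/asboolP; exists v. Qed.

Lemma hfil_decr q n x : x \in hfil (q + 1) n -> x \in hfil q n.
Proof.
case/asboolP=> v hv ->; apply: tcls_hfil; apply: cocycle_flt_le hv; lia.
Qed.

Lemma hcup_tcls p q m n u v : u \in cocycle_flt p m -> v \in cocycle_flt q n ->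
  prd u v \in cocycle_flt (p + q) (m + n) /\
  hcup (tcls m u) (tcls n v) = tcls (m + n) (prd u v).
Proof.
move=> hu hv; split; last first.
  rewrite /tcls hcupE ?(cocycle_flt_component hu) ?(cocycle_flt_component hv) //.
  congr (hcls _ _); apply/funext=> y; apply/esym/total_prd_cup.
  by case/cocycle_fltP: hu.
case/cocycle_fltP: hu hv => h1 h2 h3 /cocycle_fltP[h4 h5 h6].
apply/cocycle_fltP; split; [by rewrite PoszD; exact: prd_deg | exact: prd_flt |].
by rewrite (dif_prd _ h1) h3 h6 prd0l prd0r scaler0 addr0.
Qed.

Lemma hfil_mul p q m n x y : x \in hfil p m -> y \in hfil q n ->
  hcup x y \in hfil (p + q) (m + n).
Proof.
case/asboolP=> u hu -> /asboolP[v hv ->].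
by have [h ->] := hcup_tcls hu hv; exact: tcls_hfil.
Qed.

Variable P : nat.
Hypothesis hP : forall u : {ffun G -> k^o}, aug_pow P u -> u = 0.

Lemma hfil_exhaustive n : exists q, forall x, x \in hfil q n.
Proof.
(* At [- P] the filtration contains every cochain, by [ffilt_all] in each fibre. *)
exists (- P%:Z); apply: subquo_ind => z hz; have [h1 h2] := embed_cocycle hz.
apply/asboolP; exists (embed z).
  by apply/cocycle_fltP; split=> //; exact: total_flt_all _ hP _.
by rewrite /tcls (_ : component _ = z) //; apply/funext=> y; exact: embedE.
Qed.

Lemma hfil_separated n : exists q, forall x, x \in hfil q n -> x = 0.
Proof.
exists 1 => _ /asboolP[v /cocycle_fltP[_ hv _] ->].
by rewrite (total_flt_gt0 (ltr01 : 0 < 1 :> int) hv) /tcls cls0.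
Qed.

(* From this page on, a.2 + r > 0 and a.2 - r + 1 <= - P, so the filtration is zero
   at the target and everything at the source of the differentials at a. *)
Definition conv_stable a : nat := (absz a.2 + P).+1.

Section Stable.
Variables (r : nat) (a : int * int).
Hypothesis hr : (conv_stable a <= r)%N.

Lemma stable_flt_low q v : q <= a.2 - r%:Z + 1 -> v \in flt C q.
Proof.
by move=> h; apply: (total_flt_all v hP); move: hr; rewrite /conv_stable; lia.
Qed.

Lemma stable_flt_high q v : a.2 + r%:Z <= q -> v \in flt C q -> v = 0.
Proof.
by move=> h hv; apply: (total_flt_gt0 _ hv); move: hr; rewrite /conv_stable; lia.
Qed.

Section Edge.
Variables (n : nat) (e : a.1 + a.2 = n%:Z).

(** As the filtration vanishes from [a.2 + r] on, an almost cycle of page [r] is a genuine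
    cocycle. *)
Lemma stable_cycles v : (v \in page_cycles C r a) = (v \in cocycle_flt a.2 n).
Proof.
apply/almost_cyclesP/cocycle_fltP; rewrite e => -[h1 h2 h3]; split=> //.
  exact: stable_flt_high h3.
by rewrite h3 rpred0.
Qed.

Local Notation fcls := (cls (hfil a.2 n) (hfil (a.2 + 1) n)).

Fact edge_lin : linear_on (page_cycles C r a) (fun v => fcls (tcls n v)).
Proof.
move=> c u v; rewrite !stable_cycles => hu hv.
by rewrite (tclsD _ hu hv) clsD // tcls_hfil.
Qed.

(** An element [x + d y] of [B_r] has the cohomology class of [x], here a cocycle of filtration
    [a.2 + 1], and so dies in the associated graded. *)
Fact edge_zero v : v \in page_cycles C r a -> v \in page_boundaries C r a ->
  fcls (tcls n v) = 0.
Proof.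
rewrite stable_cycles => hv /asboolP[x [y [hx hy ev]]].
apply: cls_eq0; first exact: tcls_hfil.
apply/asboolP; exists x.
  case/almost_cyclesP: hx => h1 h2 h3; apply/cocycle_fltP; rewrite -e; split=> //.
  exact: stable_flt_high h3.
have hxc : x \in page_cycles C r a by apply: almost_cyclesW hx; lia.
rewrite stable_cycles in hxc.
apply/clsP.
- exact: cocycle_flt_component hv.
- exact: cocycle_flt_component hxc.
rewrite ev -[component _ - _]/(component (n := n) (x + dif C y - x)).
rewrite addrAC subrr add0r; apply: component_coboundary.
by case/almost_cyclesP: hy; rewrite e.
Qed.

Definition stable_edge : {linear E r a -> subquo (hfil a.2 n) (hfil (a.2 + 1) n)} :=
  subquo_lift edge_lin edge_zero.

Lemma stable_edgeE v : v \in page_cycles C r a ->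
  stable_edge (pcls r a v) = fcls (tcls n v).
Proof. exact: subquo_liftE. Qed.

Lemma stable_edge_bij : bijective stable_edge.
Proof.
have inj x : stable_edge x = 0 -> x = 0.
  move: x; apply: subquo_ind => v hv; rewrite stable_edgeE //.
  have hv' := hv; rewrite stable_cycles in hv'.
  move/(cls_eq0P (tcls_hfil hv'))/asboolP=> [w hw evw].
  have [y hy ev] := tcls_eq hv' hw evw.
  apply: cls_eq0 => //; apply/asboolP; exists w, y; split=> //.
    apply/almost_cyclesP; case/cocycle_fltP: hw => h1 h2 h3.
    by rewrite e h3 rpred0.
  (* Nothing is known about the filtration of [y], but [B_r] asks only for [a.2 - r + 1], where on a
     stable page the filtration is everything. *)
  apply/almost_cyclesP; rewrite e; split=> //; first exact: stable_flt_low.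
  have -> : dif C y = v - w by rewrite ev addrAC subrr add0r.
  apply: submodB; first by case/cocycle_fltP: hv'.
  by case/cocycle_fltP: hw => _ h2 _; apply: flt_le h2; lia.
have surj y : exists x, stable_edge x = y.
  move: y; apply: subquo_ind => _ /asboolP[v hv ->].
  by exists (pcls r a v); rewrite stable_edgeE // stable_cycles.
pose g y := projT1 (cid (surj y)).
have gK : cancel g stable_edge by move=> y; rewrite /g; case: cid.
exists g => // x; apply/eqP; rewrite -subr_eq0; apply/eqP/inj.
by rewrite linearB /= gK subrr.
Qed.

End Edge.
End Stable.

(** Edge maps are demanded on all pages; before the stable one the zero map is a default value. The
    test is phrased with a reflection so that its proof can be passed to [stable_edge]. *)
Definition conv_edge r a n (e : a.1 + a.2 = n%:Z) :
    {linear E r a -> subquo (hfil a.2 n) (hfil (a.2 + 1) n)} :=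
  if (conv_stable a <= r)%N =P true is ReflectT hr then stable_edge hr e
  else [the {linear _ -> _} of \0].

Lemma conv_edge_stable r a n (e : a.1 + a.2 = n%:Z)
  (hr : (conv_stable a <= r)%N) : conv_edge r e = stable_edge hr e.
Proof.
rewrite /conv_edge; case: eqP => [h|]; last by rewrite hr.
by rewrite (bool_irrelevance h hr).
Qed.

Lemma conv_edgeE r a n (e : a.1 + a.2 = n%:Z) v :
  (conv_stable a <= r)%N -> v \in page_cycles C r a ->
  conv_edge r e (pcls r a v) = cls _ _ (tcls n v).
Proof. by move=> hr hv; rewrite conv_edge_stable stable_edgeE. Qed.

Lemma conv_stable_out r a b (e : b = a + ddeg r) (x : E r a) :
  (conv_stable a <= r)%N -> diff (E r) e x = 0.
Proof.
move=> hr; move: x; apply: subquo_ind => v hv.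
rewrite [LHS](page_diffE e hv); case/almost_cyclesP: hv => _ _ h.
by rewrite (stable_flt_high hr (lexx _) h) cls0.
Qed.

(** The whole source vanishes: [a.2 + 1 = b.2 - r + 1] is so low that every cochain has this
    filtration, and each element of [Z_r] at [a] is a boundary of the first kind. *)
Lemma conv_stable_in r a b (e : b = a + ddeg r) (x : E r a) :
  (conv_stable b <= r)%N -> diff (E r) e x = 0.
Proof.
move=> hr; move: x; apply: subquo_ind => v hv.
rewrite (_ : pcls r a v = 0) ?linear0 //; apply: cls_eq0 => //.
case/almost_cyclesP: hv => h1 h2 h3.
apply: (page_boundaryl (n := a.1 + a.2) (q := a.2 + 1) (s := a.2 + r%:Z)) => //.
apply/almost_cyclesP; split=> //; apply: (stable_flt_low hr) => /=.
by rewrite e /=; lia.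
Qed.

Lemma conv_edge_neg r a (x : E r a) :
  (conv_stable a <= r)%N -> a.1 + a.2 < 0 -> x = 0.
Proof.
move=> _; move: x; apply: subquo_ind => v /almost_cyclesP[hv _ _] ha.
by rewrite (total_deg_neg hv ha) cls0.
Qed.

Lemma conv_edge_turn r a n (e : a.1 + a.2 = n%:Z) x :
  (conv_stable a <= r)%N ->
  conv_edge r.+1 e (turn E r a (cls _ _ x)) = conv_edge r e x.
Proof.
move=> hr; have hr' : (conv_stable a <= r.+1)%N by exact: leqW.
move: x; apply: subquo_ind => v hv.
have hv' : v \in page_cycles C r.+1 a.
  by move: hv; rewrite (stable_cycles hr e) (stable_cycles hr' e).
by rewrite [turn E r a _](page_turnE hv') !conv_edgeE.
Qed.

(** On stable pages both products come from the product of cocycles. Other representatives of the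
    two factors change it by terms in [F^(p+1) F^q] and [F^p F^(q+1)], which vanish in the
    associated graded. *)
Lemma conv_edge_mul r a b m n (ea : a.1 + a.2 = m%:Z) (eb : b.1 + b.2 = n%:Z)
    (eab : (a + b).1 + (a + b).2 = (m + n)%:Z) x y :
  (conv_stable a <= r)%N -> (conv_stable b <= r)%N ->
  (conv_stable (a + b)%R <= r)%N ->
  conv_edge r eab (mul (E r) (erefl (a + b)) x y) =
    cls _ _ (hcup (rep (conv_edge r ea x)) (rep (conv_edge r eb y))).
Proof.
move=> ha hb hab; move: x y; apply: subquo_ind => u hu; apply: subquo_ind => v hv.
have huv := page_mul_cycles (erefl (a + b)) hu hv.
rewrite [mul _ _ _ _](page_mulE (erefl (a + b)) hu hv) !conv_edgeE //.
rewrite (stable_cycles ha ea) in hu; rewrite (stable_cycles hb eb) in hv.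
have hd := cls_rep (hfil (a.2 + 1) m) (tcls_hfil hu).
have hd' := cls_rep (hfil (b.2 + 1) n) (tcls_hfil hv).
set x := rep _ in hd *; set y := rep _ in hd' *.
have hx : x \in hfil a.2 m := rep_in _.
have hy : y \in hfil b.2 n := rep_in _.
have [_ <-] := hcup_tcls hu hv.
apply/esym/clsP; try exact: hfil_mul; try by apply: hfil_mul; exact: tcls_hfil.
have [hl hr] := @hcup_bilinear k Y m n.
have -> : hcup x y - hcup (tcls m u) (tcls n v) =
    hcup (x - tcls m u) y + hcup (tcls m u) (y - tcls n v).
  have := hl y (-1) (tcls m u) x; have := hr (tcls m u) (-1) (tcls n v) y.
  by rewrite !scaleN1r ![- _ + _]addrC => -> ->; rewrite addrA subrK.
have e1 : (a + b).2 + 1 = a.2 + 1 + b.2 by rewrite /=; lia.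
have e2 : (a + b).2 + 1 = a.2 + (b.2 + 1) by rewrite /=; lia.
apply: rpredD; first by rewrite e1 hfil_mul.
by rewrite e2; apply: hfil_mul => //; exact: tcls_hfil.
Qed.

Definition twisted_convergence : convergence E Y :=
  @Defs.Convergence k E Y (fun q n => hfil q n) hfil_decr hfil_exhaustive
    hfil_separated hfil_mul conv_stable (fun=> erefl) conv_stable_out
    conv_stable_in conv_edge
    (fun r a n e hr => eq_ind_r (fun f : {linear _ -> _} => bijective f)
       (stable_edge_bij hr e) (conv_edge_stable e hr))
    conv_edge_neg conv_edge_turn conv_edge_mul.

End Convergence.

Arguments hfil {k X G F} t A q n.

(** * Naturality *)

Section Naturality.
Variables (k : fieldType).

(** The exponent [P] is chosen from [hD] and affects only the stable range and the edge maps; the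
    pages, the tensor description and the filtration of the abutment are independent of it. *)
Definition twisted_ss_of (D : twisted_data) (hD : aug_nilpotent k (td_G D)) :
  twisted_ss k D :=
  TwistedSS (twisted_first_page k (td_tau D) (td_act D))
    (twisted_convergence (td_tau D) (td_act D) (projT2 (cid hD))).

Variables (D D' : twisted_data) (hD : aug_nilpotent k (td_G D)).
Variables (hD' : aug_nilpotent k (td_G D')) (f : twisted_map D D').
Local Notation C := (twisted_cochains k (td_tau D) (td_act D)).
Local Notation C' := (twisted_cochains k (td_tau D') (td_act D')).

Lemma pull_cocycle_flt q n (v : C') : v \in cocycle_flt q n ->
  (total_pull (tm_prod f) v : C) \in cocycle_flt q n /\
  hmap (tm_prod f) (tcls n v) = tcls n (total_pull (tm_prod f) v : C).
Proof.
move=> hv; split; last by rewrite /tcls hmapE ?(cocycle_flt_component hv).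
case/cocycle_fltP: hv => h1 h2 h3; apply/cocycle_fltP; split.
- exact: total_pull_deg.
- exact: total_pull_flt.
by rewrite -[dif C _](total_pull_dif (tm_prod f)) [total_dif v]h3 linear0.
Qed.

Lemma hmap_hfil q n (x : cohomology k (td_prod D') n) :
  x \in hfil (td_tau D') (td_act D') q n ->
  hmap (tm_prod f) x \in hfil (td_tau D) (td_act D) q n.
Proof.
case/asboolP=> v hv ->; have [hv' ->] := pull_cocycle_flt hv.
exact: tcls_hfil.
Qed.

Lemma twisted_pull_induces :
  induces f (E := twisted_ss_of hD) (E' := twisted_ss_of hD')
    (fdga_ss_map (twisted_pull k f)).
Proof.
split=> [a n e x u | q n _ /asboolP[v hv ->] | r a n e x hr' hr].
- move: x u; apply: subquo_ind => z hz; apply: subquo_ind => c hc.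
  rewrite hmapE // (fgr_mapE (tm_act f) hc).
  rewrite [tens _ e _ _](page1_tensE (td_tau D') e hz hc).
  have hz' := pull_cocycles (tm_X f) hz.
  have hc' := ffilt_map (A := td_act D) (tm_act f) hc.
  rewrite [RHS](page1_tensE (td_tau D) e hz' hc').
  rewrite [LHS](fdga_pageE (twisted_pull k f) (cross_page_cycles _ e hz hc)).
  congr (cls _ _ _); apply/funext=> -[m [x y]].
  rewrite -[LHS]/(embed z (existT _ m (tm_X f m x)) * c (tm_F f y)).
  rewrite -[RHS]/(embed (pull (tm_X f) z) (existT _ m x) * c (tm_F f y)).
  congr (_ * _); have [em|em] := eqVneq m n; last first.
    by rewrite !embed_out //; exact/eqP.
  by subst m; rewrite !embedE.
- exact: hmap_hfil (tcls_hfil hv).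
move: x; apply: subquo_ind => v hv.
have hv' := fdga_page_cycles (twisted_pull k f) hv.
rewrite [X in edge _ _ _ X](fdga_pageE (twisted_pull k f) hv).
rewrite [LHS](conv_edgeE e hr hv').
rewrite [edge _ _ _ _](conv_edgeE e hr' hv).
rewrite (stable_cycles hr' e) in hv.
have [hw e1] := pull_cocycle_flt hv.
have hd := cls_rep (hfil (td_tau D') (td_act D') (a.2 + 1) n) (tcls_hfil hv).
set x := rep _ in hd *.
have hx : x \in hfil (td_tau D') (td_act D') a.2 n := rep_in _.
apply/clsP; [exact: tcls_hfil | exact: hmap_hfil |].
(* [cls_rep] gives the difference in the order opposite to the one needed here, hence the sign. *)
have := hmap_hfil (submodN hd).
have -> : - (x - tcls n v) = -1 *: x + tcls n v by rewrite opprB addrC scaleN1r.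
by rewrite hmap_linear scaleN1r e1 addrC.
Qed.

End Naturality.

Theorem proposition11p4 (k : fieldType) :
  exists S : forall D : twisted_data, aug_nilpotent k (td_G D) -> twisted_ss k D,
  forall (D D' : twisted_data) (hD : aug_nilpotent k (td_G D))
    (hD' : aug_nilpotent k (td_G D')) (f : twisted_map D D'),
  exists phi : ss_map (S D' hD') (S D hD), induces f phi.
Proof.
exists (@twisted_ss_of k) => D D' hD hD' f.
exists (fdga_ss_map (twisted_pull k f)); exact: twisted_pull_induces.
Qed.
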